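(* For every positive integer $m$, $$S_{4m+1}(2\pi) = I_{4m+1}(2\pi(1+i)) + (-1)^m \left[ \frac{T_{4m+1}(2\pi)}{4^m} + 2\cdot 4^m S_{4m+1}(2\pi) - 4^m I_{4m+1}(\pi) \right].$$
   Context: For $s \in \mathbb{C}$ and $\operatorname{Re} x > 0$: $S_s(x) = \sum_{n=1}^{\infty} \frac{1}{n^s (e^{xn} - 1)}$ and $T_s(x) = \sum_{n=1}^{\infty} \frac{1}{n^s (e^{xn} + 1)}$. For odd $k \geq 3$ and $x \in \mathbb{C}\setminus\{0\}$, $$I_k(x) = -\frac{1}{2}\zeta(k)\left[1 - \left(\frac{x}{2\pi i}\right)^{k-1}\right] - \frac{1}{2x\,(k+1)!} \sum_{j=0}^{(k+1)/2} \binom{k+1}{2j} x^{2j} (2\pi i)^{k+1-2j} B_{2j} B_{k+1-2j},$$ where $\zeta$ is the Riemann zeta function and $B_n$ are the Bernoulli numbers. *)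

(* Defs.v *)
From Stdlib Require Import Reals Arith Lia.
From Coquelicot Require Import Coquelicot.

Open Scope C_scope.

Definition Cexp (z : C) : C :=
  (exp (Re z) * cos (Im z), exp (Re z) * sin (Im z))%R.

(* [a 0 + a 1 + ...]; the components are total, and have their usual meaning
   when the series converges. *)
Definition CSeries (a : nat -> C) : C :=
  (Series (fun n => Re (a n)), Series (fun n => Im (a n))).

(* [n ^ s] for [n >= 1], with the real logarithm of [n]. *)
Definition npow (n : nat) (s : C) : C := Cexp (s * RtoC (ln (INR n))).

(* Meant for [0 < Re x]; the sum over [n >= 1] is reindexed from 0. *)
Definition S_fun (s x : C) : C :=
  CSeries (fun n => / (npow (S n) s * (Cexp (x * RtoC (INR (S n))) - 1))).

Definition T_fun (s x : C) : C :=
  CSeries (fun n => / (npow (S n) s * (Cexp (x * RtoC (INR (S n))) + 1))).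

(* The Riemann zeta function on the half-plane [1 < Re s]; elsewhere this is
   not the analytic continuation. *)
Definition zeta (s : C) : C := CSeries (fun n => / npow (S n) s).

(* [bernoulli_upto n] agrees with the Bernoulli numbers on indices [<= n]. *)
Fixpoint bernoulli_upto (n : nat) : nat -> R :=
  match n with
  | O => fun _ => 1%R
  | S p => fun j =>
      if (j <=? p)%nat then bernoulli_upto p j
      else (- sum_f_R0 (fun i => Binomial.C (n + 1) i * bernoulli_upto p i) p
            / INR (n + 1))%R
  end.

(* Convention [B_1 = -1/2]. *)
Definition bernoulli (n : nat) : R := bernoulli_upto n n.

Lemma bernoulli_upto_le (n j : nat) :
  (j <= n)%nat -> bernoulli_upto n j = bernoulli j.
Proof.
induction n as [|n IH]; intros Hj.
- now replace j with 0%nat by lia.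
- destruct (Nat.eq_dec j (S n)) as [->|Hne]; [reflexivity|].
  change (bernoulli_upto (S n) j) with
    (if (j <=? n)%nat then bernoulli_upto n j
     else (- sum_f_R0 (fun i => Binomial.C (S n + 1) i * bernoulli_upto n i) n
           / INR (S n + 1))%R).
  destruct (Nat.leb_spec j n); [apply IH|]; lia.
Qed.

Lemma bernoulli_0 : bernoulli 0 = 1%R.
Proof. reflexivity. Qed.

Lemma bernoulli_rec (n : nat) :
  sum_f_R0 (fun i => Binomial.C (n + 2) i * bernoulli i)%R (S n) = 0%R.
Proof.
assert (Hs : bernoulli (S n) =
  (- sum_f_R0 (fun i => Binomial.C (n + 2) i * bernoulli i) n / INR (n + 2))%R).
{ unfold bernoulli at 1.
  change (bernoulli_upto (S n) (S n)) with
    (if (S n <=? n)%nat then bernoulli_upto n (S n)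
     else (- sum_f_R0 (fun i => Binomial.C (S n + 1) i * bernoulli_upto n i) n
           / INR (S n + 1))%R).
  destruct (Nat.leb_spec (S n) n) as [Hle|_]; [lia|].
  replace (S n + 1)%nat with (n + 2)%nat by lia.
  do 2 f_equal; apply sum_eq; intros i Hi.
  now rewrite bernoulli_upto_le. }
rewrite tech5, Hs.
replace (Binomial.C (n + 2) (S n)) with (INR (n + 2)).
- field; apply not_0_INR; lia.
- replace (n + 2)%nat with (S (S n)) by lia.
  unfold Binomial.C. replace (S (S n) - S n)%nat with 1%nat by lia.
  rewrite (fact_simpl (S n)), mult_INR; simpl (INR (fact 1)).
  field; apply INR_fact_neq_0.
Qed.

(* Meant for [k] odd, [3 <= k], and [x <> 0]. *)
Definition I_fun (k : nat) (x : C) : C :=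
  - (1 / 2) * zeta (RtoC (INR k)) * (1 - (x / (2 * RtoC PI * Ci)) ^ (k - 1))
  - 1 / (2 * x * RtoC (INR (fact (k + 1))))
    * sum_n (fun j : nat =>
        RtoC (Binomial.C (k + 1) (2 * j)) * x ^ (2 * j)
        * (2 * RtoC PI * Ci) ^ (k + 1 - 2 * j)
        * RtoC (bernoulli (2 * j)) * RtoC (bernoulli (k + 1 - 2 * j)) : C)
      ((k + 1) / 2).

(* Main.v *)
Require Import Defs.
From Stdlib Require Import Reals Arith Lra Lia.
From Coquelicot Require Import Coquelicot.

(** Let k = 4m + 1 and Re t > 0. Expanding 1 / (e^(2 pi t n) - 1) + 1/2 in partial fractions
    turns S_k(2 pi t) + zeta(k) / 2 into a double series of n^(1-k) / (t^2 n^2 + l^2). Since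
    k - 1 is divisible by 4, the difference n^(1-k) - (t / l)^(k-1) is (t^2 n^2 + l^2) times a
    Laurent polynomial in n^2 and l^2; hence exchanging the two summations replaces t by 1/t up
    to finitely many products of even zeta values. By Euler's formula those products add up to
    I_k, and
      S_k(2 pi t) = I_k(2 pi t) + t^(4m) S_k(2 pi / t).
    The theorem combines the cases t = 1 + i (where S_k(2 pi t) = S_k(2 pi) by periodicity and
    2 pi / t = pi - pi i) and t = 1/2 with 1 / (e^y + 1) = 1 / (e^y - 1) - 2 / (e^(2y) - 1).

    The partial fractions come from the integrals I_n and J_n of cosh (2 w u) cos(u)^n and
    u sinh (2 w u) cos(u)^n over [0, pi/2]. Integration by parts gives
      J_n / I_n = J_(n+2) / I_(n+2) + 4 w / (4 w^2 + (n+2)^2),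
    where J_0 / I_0 is explicit and J_n / I_n = O(1/n). *)

Open Scope R_scope.

(** * Moments of powers of the cosine *)

(** The integral ratios give the expansion for every complex [w] with [0 < Re w] at once, as a
    telescoping sum whose remainder is controlled by a moment estimate, so neither residues nor
    continuation from the real axis are involved. The price is that no [I_n] with even [n] may
    vanish. Euler's formula comes from the same expansion at real [z]: for [|z| < 1] it becomes a
    power series in [z^2] with zeta values as coefficients, which is essentially the Taylor series
    of [2 pi z / (e^(2 pi z) - 1)]. Multiplication by the series of the reciprocal function then
    reproduces the recursion of [bernoulli]. The terms of [I_k] have three sources. The summand 1/2
    of the expansion yields those with [zeta(k)]. The term [-1/(2w)] yields [zeta(k+1)], once for
    [t] and once for [1/t]; these are [j = 0] and [j = (k+1)/2], where [B_0 = 1] occurs. The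
    products of two even zeta values are the inner [j]. With [M = 2m - 1] one has [k = 2M + 3], and
    the geometric sum behind the Laurent polynomial has [M + 1] terms, an even number; this parity
    fixes all signs. *)

Definition cosmom (n : nat) (f : R -> R) : R :=
  RInt (fun u => f u * cos u ^ n) 0 (PI / 2).

Lemma ex_RInt_cosmom (n : nat) (f : R -> R) :
  (forall u, continuous f u) -> ex_RInt (fun u => f u * cos u ^ n) 0 (PI / 2).
Proof.
intros Hf; apply (ex_RInt_continuous (V := R_CompleteNormedModule)); intros u _.
apply (continuous_mult (K := R_AbsRing)); [apply Hf|].
apply (ex_derive_continuous (V := R_NormedModule)); auto_derive; trivial.
Qed.

Lemma cosmom_plus (n : nat) (f g : R -> R) :
  (forall u, continuous f u) -> (forall u, continuous g u) ->
  cosmom n (fun u => f u + g u) = cosmom n f + cosmom n g.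
Proof.
intros Hf Hg; unfold cosmom.
rewrite <- (RInt_plus (V := R_CompleteNormedModule))
  by now apply ex_RInt_cosmom.
apply RInt_ext; intros; unfold plus; simpl; ring.
Qed.

Lemma cosmom_scal (n : nat) (c : R) (f : R -> R) :
  (forall u, continuous f u) -> cosmom n (fun u => c * f u) = c * cosmom n f.
Proof.
intros Hf; unfold cosmom.
rewrite <- (RInt_scal (V := R_CompleteNormedModule))
  by now apply ex_RInt_cosmom.
apply RInt_ext; intros; unfold scal; simpl; unfold mult; simpl; ring.
Qed.

Lemma cosmom_ext (n : nat) (f g : R -> R) :
  (forall u, f u = g u) -> cosmom n f = cosmom n g.
Proof. intros H; apply RInt_ext; intros; now rewrite H. Qed.

Lemma cosmom_le (n : nat) (f g : R -> R) :
  (forall u, continuous f u) -> (forall u, continuous g u) ->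
  (forall u, 0 <= u <= PI / 2 -> f u <= g u) -> cosmom n f <= cosmom n g.
Proof.
intros Hf Hg H; assert (HPI := PI_RGT_0).
apply RInt_le; [lra | now apply ex_RInt_cosmom | now apply ex_RInt_cosmom |].
intros u Hu; apply Rmult_le_compat_r; [|apply H; lra].
apply pow_le, cos_ge_0; lra.
Qed.

(** Integration of the derivative of [(n+2) f cos^(n+1) sin + f' cos^(n+2)], in which the mixed
    terms with [f'] cancel and [sin^2 = 1 - cos^2] is used. The boundary values vanish: at [PI / 2]
    because of the cosine, at 0 because of [sin 0 = 0] and [f' 0 = 0]. When [f''] is a multiple of
    [f], this is a recursion in [n]. *)
Lemma cosmom_red (f f' f'' : R -> R) (n : nat) :
  (forall u, is_derive f u (f' u)) -> (forall u, is_derive f' u (f'' u)) ->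
  (forall u, continuous f'' u) -> f' 0 = 0 ->
  cosmom (n + 2) f'' + INR (n + 2) ^ 2 * cosmom (n + 2) f =
  INR (n + 2) * INR (n + 1) * cosmom n f.
Proof.
intros Df Df' Cf'' H0.
assert (Cf : forall u, continuous f u)
  by (intros u; apply (ex_derive_continuous (V := R_NormedModule)); now exists (f' u)).
pose (G := fun u => INR (n + 2) * f u * cos u ^ (n + 1) * sin u + f' u * cos u ^ (n + 2)).
pose (H := fun u => (f'' u + INR (n + 2) ^ 2 * f u) * cos u ^ (n + 2)
   + - (INR (n + 2) * INR (n + 1)) * f u * cos u ^ n).
assert (HG : is_RInt H 0 (PI / 2) (minus (G (PI / 2)) (G 0))).
{ apply (is_RInt_derive (V := R_CompleteNormedModule)).
  - intros u _; unfold G, H.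
    auto_derive.
    + repeat split; [exists (f' u) | exists (f'' u)]; easy.
    + replace (Derive (fun x => f x) u) with (f' u)
        by (symmetry; now apply is_derive_unique).
      replace (Derive (fun x => f' x) u) with (f'' u)
        by (symmetry; now apply is_derive_unique).
      replace (n + 2)%nat with (S (S n)) by lia.
      replace (n + 1)%nat with (S n) by lia.
      simpl pred; rewrite !S_INR; simpl pow.
      assert (Hs : sin u * sin u = 1 - cos u * cos u)
        by (generalize (sin2_cos2 u); unfold Rsqr; lra).
      match goal with |- ?a = ?b => 
        replace a with ((INR n + 1 + 1) * f u * cos u * (cos u ^ n * cos u) 
         + - ((INR n + 1 + 1) * (INR n + 1) * f u * cos u ^ n) * (sin u * sin u)
         + f'' u * (cos u * (cos u * cos u ^ n))) by ring end.
      rewrite Hs; ring.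
  - intros u _; unfold H.
    apply (continuous_plus (V := R_NormedModule)).
    + apply (continuous_mult (K := R_AbsRing)).
      * apply (continuous_plus (V := R_NormedModule)); [apply Cf''|].
        apply (continuous_mult (K := R_AbsRing)); [apply continuous_const|apply Cf].
      * apply (ex_derive_continuous (V := R_NormedModule)); auto_derive; trivial.
    + apply (continuous_mult (K := R_AbsRing)).
      * apply (continuous_mult (K := R_AbsRing)); [apply continuous_const|apply Cf].
      * apply (ex_derive_continuous (V := R_NormedModule)); auto_derive; trivial. }
assert (E : minus (G (PI / 2)) (G 0) = 0).
{ unfold G, minus, plus, opp; simpl.
  replace (n + 2)%nat with (S (n + 1)) by lia.
  rewrite cos_PI2, sin_0, H0, !pow_i by lia; ring. }
rewrite E in HG; apply (is_RInt_unique (V := R_CompleteNormedModule)) in HG.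
assert (E2 : RInt H 0 (PI / 2) =
  cosmom (n + 2) f'' + INR (n + 2) ^ 2 * cosmom (n + 2) f
   + - (INR (n + 2) * INR (n + 1)) * cosmom n f).
{ rewrite <- !cosmom_scal by easy.
  rewrite <- cosmom_plus; [|easy|].
  2: intros u; apply (continuous_mult (K := R_AbsRing)); [apply continuous_const|apply Cf].
  unfold cosmom; rewrite <- (RInt_plus (V := R_CompleteNormedModule)).
  - now apply RInt_ext.
  - apply ex_RInt_cosmom; intros u.
    apply (continuous_plus (V := R_NormedModule)); [apply Cf''|].
    apply (continuous_mult (K := R_AbsRing)); [apply continuous_const|apply Cf].
  - apply ex_RInt_cosmom; intros u.
    apply (continuous_mult (K := R_AbsRing)); [apply continuous_const|apply Cf]. }
lra.
Qed.

Lemma cosmom_0 (f f' : R -> R) :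
  (forall u, is_derive f u (f' u)) -> (forall u, continuous f' u) ->
  cosmom 0 f' = f (PI / 2) - f 0.
Proof.
intros D C; unfold cosmom; apply is_RInt_unique.
apply (is_RInt_ext f'); [intros; simpl; ring|].
apply (is_RInt_derive (V := R_CompleteNormedModule)); easy.
Qed.

(* Wallis' recursion [(n+2) W_(n+2) = (n+1) W_n] for [W_n = int cos^n], as [sin^2 = 1 - cos^2]. *)
Lemma cosmom_sin2 (n : nat) :
  cosmom n (fun u => sin u ^ 2) = cosmom n (fun _ => 1) / INR (n + 2).
Proof.
assert (Hn : INR (n + 2) = INR (n + 1) + 1)
  by (rewrite <- S_INR; f_equal; lia).
assert (Hp := pos_INR (n + 1)).
assert (H := cosmom_red (fun _ => 1) (fun _ => 0) (fun _ => 0) n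
  (fun u => is_derive_const (V := R_NormedModule) _ _)
  (fun u => is_derive_const (V := R_NormedModule) _ _)
  (fun u => continuous_const _ _) eq_refl).
assert (H0 : cosmom (n + 2) (fun _ => 0) = 0).
{ rewrite (cosmom_ext _ _ (fun _ => 0 * 1)) by (intros; ring).
  rewrite cosmom_scal; [ring|intros; apply continuous_const]. }
rewrite H0 in H.
assert (H1 : cosmom n (fun u => sin u ^ 2) =
  cosmom n (fun _ => 1) + - cosmom (n + 2) (fun _ => 1)).
{ replace (- cosmom (n + 2) (fun _ => 1)) with (-1 * cosmom (n + 2) (fun _ => 1)) by ring.
  replace (cosmom (n + 2) (fun _ => 1)) with (cosmom n (fun u => cos u ^ 2)).
  2: apply RInt_ext; intros; rewrite pow_add; simpl; ring.
  assert (C : forall u, continuous (fun u => cos u ^ 2) u)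
   by (intros u; apply (ex_derive_continuous (V := R_NormedModule)); auto_derive; trivial).
  rewrite <- cosmom_scal by easy.
  rewrite <- cosmom_plus.
  - apply cosmom_ext; intros u; generalize (sin2_cos2 u); unfold Rsqr; simpl; lra.
  - intros; apply continuous_const.
  - intros u; apply (continuous_mult (K := R_AbsRing)); [apply continuous_const|apply C]. }
rewrite H1.
assert (H2 : INR (n + 2) * cosmom (n + 2) (fun _ => 1) = INR (n + 1) * cosmom n (fun _ => 1))
  by (apply (Rmult_eq_reg_l (INR (n + 2))); nra).
apply (Rmult_eq_reg_l (INR (n + 2))); [|lra].
replace (INR (n + 2) * (cosmom n (fun _ => 1) / INR (n + 2)))
  with (cosmom n (fun _ => 1)) by (field; lra).
rewrite Rmult_plus_distr_l, Ropp_mult_distr_r_reverse, H2, Hn; ring.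
Qed.

Lemma cosmom_1_pos (n : nat) : 0 < cosmom n (fun _ => 1).
Proof.
apply RInt_gt_0.
- assert (H := PI_RGT_0); lra.
- intros u Hu; rewrite Rmult_1_l; apply pow_lt, cos_gt_0; lra.
- intros u Hu; apply (ex_derive_continuous (V := R_NormedModule)); auto_derive; trivial.
Qed.

(** From [u - u^3 / 6 <= sin u] and [u^2 <= 4]. The sharp constant [PI / 2] would bring nothing
    here. *)
Lemma le_3_sin (u : R) : 0 <= u <= PI / 2 -> u <= 3 * sin u.
Proof.
intros Hu; assert (H4 := PI_4).
assert (H := proj1 (pre_sin_bound u 0 (proj1 Hu) ltac:(lra))).
unfold sin_approx, sin_term in H; simpl in H.
assert (u * u <= 4) by nra.
assert (u * (u * u) <= u * 4) by (apply Rmult_le_compat_l; lra).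
lra.
Qed.

(** Two applications of the mean value theorem give [|f u| <= K u^2] with [K] the maximum of
    [|f''|], hence [|f u| <= 9 K sin^2 u]. The moment of [sin^2] is smaller than that of 1 by the
    factor [n + 2]. *)
Lemma cosmom_quadratic_le (f f' f'' : R -> R) :
  (forall u, is_derive f u (f' u)) -> (forall u, is_derive f' u (f'' u)) ->
  (forall u, continuous f'' u) -> f 0 = 0 -> f' 0 = 0 ->
  exists K, forall n, Rabs (cosmom n f) <= K * cosmom n (fun _ => 1) / INR (n + 2).
Proof.
intros Df Df' Cf'' H0 H0'; assert (HPI := PI_RGT_0).
assert (Cf : forall u, continuous f u)
  by (intros u; apply (ex_derive_continuous (V := R_NormedModule)); now exists (f' u)).
destruct (continuity_ab_maj (fun u => Rabs (f'' u)) 0 (PI / 2)) as [v [Hv _]]; [lra| |].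
{ intros u _; apply continuity_pt_filterlim.
  apply (continuous_comp f'' Rabs); [apply Cf''|apply continuous_Rabs]. }
set (K := Rabs (f'' v)) in Hv.
assert (B1 : forall u, 0 <= u <= PI / 2 -> Rabs (f' u) <= K * u).
{ intros u Hu.
  destruct (MVT_gen f' 0 u f'') as [c [Hc E]].
  - intros x _; apply Df'.
  - intros x _; apply continuity_pt_filterlim, (ex_derive_continuous (V := R_NormedModule)).
    now exists (f'' x).
  - rewrite Rmin_left, Rmax_right in Hc by lra.
    replace (f' u) with (f'' c * u) by lra.
    rewrite Rabs_mult, (Rabs_pos_eq u) by lra.
    apply Rmult_le_compat_r; [lra|apply Hv; lra]. }
assert (K0 : 0 <= K) by apply Rabs_pos.
assert (B2 : forall u, 0 <= u <= PI / 2 -> Rabs (f u) <= 9 * K * sin u ^ 2).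
{ intros u Hu.
  destruct (MVT_gen f 0 u f') as [c [Hc E]].
  - intros x _; apply Df.
  - intros x _; apply continuity_pt_filterlim, Cf.
  - rewrite Rmin_left, Rmax_right in Hc by lra.
    replace (f u) with (f' c * u) by lra.
    rewrite Rabs_mult, (Rabs_pos_eq u) by lra.
    assert (Hs := le_3_sin u Hu).
    apply Rle_trans with (K * u * u).
    + apply Rmult_le_compat_r; [lra|].
      apply Rle_trans with (K * c); [apply B1; lra|apply Rmult_le_compat_l; lra].
    + replace (9 * K * sin u ^ 2) with (K * (3 * sin u) * (3 * sin u)) by ring.
      apply Rmult_le_compat; [nra|lra|apply Rmult_le_compat_l; lra|easy]. }
exists (9 * K); intros n.
assert (Cs : forall u, continuous (fun u => sin u ^ 2) u)
  by (intros u; apply (ex_derive_continuous (V := R_NormedModule)); auto_derive; trivial).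
replace (9 * K * cosmom n (fun _ => 1) / INR (n + 2))
  with (9 * K * cosmom n (fun u => sin u ^ 2)) by (rewrite cosmom_sin2; unfold Rdiv; ring).
assert (Ck : forall c u, continuous (fun u => c * sin u ^ 2) u)
  by (intros c u; apply (continuous_mult (K := R_AbsRing)); [apply continuous_const|apply Cs]).
apply Rabs_le; split.
- replace (- (9 * K * cosmom n (fun u => sin u ^ 2)))
    with (-(9 * K) * cosmom n (fun u => sin u ^ 2)) by ring.
  rewrite <- cosmom_scal by easy.
  apply cosmom_le; [apply Ck|apply Cf|].
  intros u Hu; generalize (B2 u Hu); unfold Rabs; destruct Rcase_abs; lra.
- rewrite <- cosmom_scal by easy.
  apply cosmom_le; [apply Cf|apply Ck|].
  intros u Hu; generalize (B2 u Hu); unfold Rabs; destruct Rcase_abs; lra.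
Qed.

(** * Series of complex numbers *)

Open Scope C_scope.

Definition is_Cseries (a : nat -> C) (l : C) : Prop :=
  is_series (K := C_AbsRing) (V := C_NormedModule) a l.

Lemma is_Cseries_of_bound (a : nat -> C) (l : C) (e : nat -> R) :
  eventually (fun N => (Cmod (sum_n (G := C_AbelianMonoid) a N - l) <= e N)%R) ->
  is_lim_seq e 0 -> is_Cseries a l.
Proof.
intros Ha He.
apply filterlim_locally; intros eps.
apply is_lim_seq_spec in He; specialize (He eps).
generalize (filter_and _ _ Ha He); apply filter_imp; intros N [H1 H2].
apply C_NormedModule_mixin_compat1.
apply Rle_lt_trans with (e N); [exact H1|].
rewrite Rminus_0_r in H2; exact (Rle_lt_trans _ _ _ (Rle_abs _) H2).
Qed.

Lemma Re_sum_n (a : nat -> C) (N : nat) :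
  Re (sum_n (G := C_AbelianMonoid) a N) = sum_n (fun n => Re (a n)) N.
Proof.
induction N as [|N IH]; [now rewrite !sum_O|].
rewrite !sum_Sn, <- IH; reflexivity.
Qed.

Lemma Im_sum_n (a : nat -> C) (N : nat) :
  Im (sum_n (G := C_AbelianMonoid) a N) = sum_n (fun n => Im (a n)) N.
Proof.
induction N as [|N IH]; [now rewrite !sum_O|].
rewrite !sum_Sn, <- IH; reflexivity.
Qed.

Lemma is_Cseries_Re (a : nat -> C) (l : C) :
  is_Cseries a l -> is_series (fun n => Re (a n)) (Re l).
Proof.
intros H; apply filterlim_locally; intros eps.
assert (H1 := proj1 (filterlim_locally _ _) H eps); revert H1.
apply filter_imp; intros N [H1 _].
rewrite <- Re_sum_n; exact H1.
Qed.

Lemma is_Cseries_Im (a : nat -> C) (l : C) :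
  is_Cseries a l -> is_series (fun n => Im (a n)) (Im l).
Proof.
intros H; apply filterlim_locally; intros eps.
assert (H1 := proj1 (filterlim_locally _ _) H eps); revert H1.
apply filter_imp; intros N [_ H1].
rewrite <- Im_sum_n; exact H1.
Qed.

Lemma CSeries_unique (a : nat -> C) (l : C) : is_Cseries a l -> CSeries a = l.
Proof.
intros H; apply injective_projections.
- now apply is_series_unique, is_Cseries_Re.
- now apply is_series_unique, is_Cseries_Im.
Qed.

(** * Complex-valued functions of a real variable and their moments *)

Definition cder (F F' : R -> C) : Prop := forall u,
  is_derive (fun v => Re (F v)) u (Re (F' u)) /\
  is_derive (fun v => Im (F v)) u (Im (F' u)).

Lemma cder_ext (F F1' F2' : R -> C) :
  (forall u, F1' u = F2' u) -> cder F F1' -> cder F F2'.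
Proof. intros E H u; rewrite <- E; apply H. Qed.

Lemma cder_plus (F F' G G' : R -> C) :
  cder F F' -> cder G G' -> cder (fun u => F u + G u) (fun u => F' u + G' u).
Proof.
intros HF HG u; destruct (HF u), (HG u); split;
  now apply (is_derive_plus (V := R_NormedModule)).
Qed.

Lemma cder_const (z : C) : cder (fun _ => z) (fun _ => 0).
Proof. intros u; split; apply (is_derive_const (V := R_NormedModule)). Qed.

Lemma cder_scal (z : C) (F F' : R -> C) :
  cder F F' -> cder (fun u => z * F u) (fun u => z * F' u).
Proof.
intros HF u; destruct (HF u) as [H1 H2]; destruct z as [x y]; simpl; split.
- apply (is_derive_minus (V := R_NormedModule) (fun v => x * Re (F v))%R (fun v => y * Im (F v))%R);
   now apply is_derive_scal.
- apply (is_derive_plus (V := R_NormedModule) (fun v => x * Im (F v))%R (fun v => y * Re (F v))%R);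
   now apply is_derive_scal.
Qed.

Lemma cder_id_mult (F F' : R -> C) :
  cder F F' -> cder (fun u => RtoC u * F u) (fun u => F u + RtoC u * F' u).
Proof.
intros HF u; destruct (HF u) as [H1 H2].
assert (E : forall (G : R -> R) d, is_derive G u d -> 
   is_derive (fun v => v * G v)%R u (G u + u * d)%R).
{ intros G d HG. auto_derive; [now exists d|].
  replace (Derive (fun x => G x) u) with d by (symmetry; now apply is_derive_unique). ring. }
split.
- apply (is_derive_ext (fun v => v * Re (F v))%R).
  { intros v; simpl; unfold Re; ring. }
  replace (Re (F u + RtoC u * F' u)) with (Re (F u) + u * Re (F' u))%R
    by (simpl; unfold Re; ring).
  now apply (E (fun v => Re (F v))).
- apply (is_derive_ext (fun v => v * Im (F v))%R).
  { intros v; simpl; unfold Im; ring. }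
  replace (Im (F u + RtoC u * F' u)) with (Im (F u) + u * Im (F' u))%R
    by (simpl; unfold Im; ring).
  now apply (E (fun v => Im (F v))).
Qed.

Lemma cder_Cexp (a : C) :
  cder (fun u => Cexp (a * RtoC u)) (fun u => a * Cexp (a * RtoC u)).
Proof.
intros u; destruct a as [p q].
assert (E : forall v : R, (p, q) * RtoC v = (p * v, q * v)%R)
  by (intros v; apply injective_projections; simpl; ring).
split.
- apply (is_derive_ext (fun v => exp (p * v) * cos (q * v))%R).
  { intros v; now rewrite E. }
  rewrite E; simpl; auto_derive; trivial; ring.
- apply (is_derive_ext (fun v => exp (p * v) * sin (q * v))%R).
  { intros v; now rewrite E. }
  rewrite E; simpl; auto_derive; trivial; ring.
Qed.

Definition ccont (F : R -> C) : Prop := forall u,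
  continuous (fun v => Re (F v)) u /\ continuous (fun v => Im (F v)) u.

Lemma cder_ccont (F F' : R -> C) : cder F F' -> ccont F.
Proof.
intros H u; destruct (H u); split;
  apply (ex_derive_continuous (V := R_NormedModule)); eexists; eassumption.
Qed.

(** Taken by components, like [cder] and [ccont], so that each fact about complex moments is the
    pair of the real facts for [Re] and [Im]. *)
Definition cmom (n : nat) (F : R -> C) : C :=
  (cosmom n (fun u => Re (F u)), cosmom n (fun u => Im (F u))).

Lemma cmom_plus (n : nat) (F G : R -> C) : ccont F -> ccont G ->
  cmom n (fun u => F u + G u) = cmom n F + cmom n G.
Proof.
intros HF HG; apply injective_projections; simpl;
  apply cosmom_plus; intros; (apply HF || apply HG).
Qed.

Lemma cmom_scal (n : nat) (z : C) (F : R -> C) : ccont F ->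
  cmom n (fun u => z * F u) = z * cmom n F.
Proof.
intros HF; destruct z as [x y].
assert (Cs : forall c G u, (forall u, continuous G u) -> continuous (fun v : R => c * G v)%R u)
 by (intros; apply (continuous_mult (K := R_AbsRing)); [apply continuous_const|easy]).
apply injective_projections; simpl.
- rewrite (cosmom_ext _ _ (fun u => x * Re (F u) + - y * Im (F u))%R)
    by (intros; unfold Re, Im; ring).
  rewrite cosmom_plus by (intros; apply Cs; intros; apply HF).
  rewrite !cosmom_scal by (intros; apply HF); ring.
- rewrite (cosmom_ext _ _ (fun u => x * Im (F u) + y * Re (F u))%R)
    by (intros; unfold Re, Im; ring).
  rewrite cosmom_plus by (intros; apply Cs; intros; apply HF).
  rewrite !cosmom_scal by (intros; apply HF); ring.
Qed.

Lemma cmom_red (n : nat) (F F' F'' : R -> C) :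
  cder F F' -> cder F' F'' -> ccont F'' -> F' 0%R = 0 ->
  cmom (n + 2) F'' + RtoC (INR (n + 2)) ^ 2 * cmom (n + 2) F =
  RtoC (INR (n + 2)) * RtoC (INR (n + 1)) * cmom n F.
Proof.
intros D1 D2 C H0.
apply injective_projections.
- generalize (cosmom_red _ _ _ n (fun u => proj1 (D1 u)) (fun u => proj1 (D2 u))
    (fun u => proj1 (C u)) (f_equal Re H0)); simpl; lra.
- generalize (cosmom_red _ _ _ n (fun u => proj2 (D1 u)) (fun u => proj2 (D2 u))
    (fun u => proj2 (C u)) (f_equal Im H0)); simpl; lra.
Qed.

Lemma cmom_0 (F F' : R -> C) : cder F F' -> ccont F' ->
  cmom 0 F' = F (PI / 2)%R - F 0%R.
Proof.
intros D C; apply injective_projections.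
- exact (cosmom_0 _ _ (fun u => proj1 (D u)) (fun u => proj1 (C u))).
- exact (cosmom_0 _ _ (fun u => proj2 (D u)) (fun u => proj2 (C u))).
Qed.

Lemma Cmod_le_Re_Im (z : C) : (Cmod z <= Rabs (Re z) + Rabs (Im z))%R.
Proof.
destruct z as [x y]; simpl.
replace (x, y) with (RtoC x + Ci * RtoC y) by (apply injective_projections; simpl; ring).
eapply Rle_trans; [apply Cmod_triangle|].
rewrite Cmod_mult, Cmod_Ci, !Cmod_R; lra.
Qed.

Lemma cmom_quadratic_le (F F' F'' : R -> C) :
  cder F F' -> cder F' F'' -> ccont F'' -> F 0%R = 0 -> F' 0%R = 0 ->
  exists K : R, forall n : nat,
    (Cmod (cmom n F) <= K * cosmom n (fun _ => 1) / INR (n + 2))%R.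
Proof.
intros D1 D2 C H0 H0'.
destruct (cosmom_quadratic_le _ _ _ (fun u => proj1 (D1 u)) (fun u => proj1 (D2 u))
    (fun u => proj1 (C u)) (f_equal Re H0) (f_equal Re H0')) as [K1 H1].
destruct (cosmom_quadratic_le _ _ _ (fun u => proj2 (D1 u)) (fun u => proj2 (D2 u))
    (fun u => proj2 (C u)) (f_equal Im H0) (f_equal Im H0')) as [K2 H2].
exists (K1 + K2)%R; intros n.
eapply Rle_trans; [apply Cmod_le_Re_Im|].
eapply Rle_trans; [apply (Rplus_le_compat _ _ _ _ (H1 n) (H2 n))|].
right; unfold Rdiv; ring.
Qed.

Lemma cmom_m1 (n : nat) : cmom n (fun _ => - (1)) = - RtoC (cosmom n (fun _ => 1%R)).
Proof.
apply injective_projections; simpl.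
- rewrite <- (Rmult_1_l (cosmom n (fun _ => 1%R))), <- Ropp_mult_distr_l_reverse.
  rewrite <- cosmom_scal by (intros; apply continuous_const).
  apply cosmom_ext; intros; simpl; ring.
- rewrite (cosmom_ext _ _ (fun _ => 0 * 1)%R) by (intros; simpl; ring).
  rewrite cosmom_scal by (intros; apply continuous_const); ring.
Qed.

(** * The complex exponential *)

Lemma Cexp_plus (x y : C) : Cexp (x + y) = Cexp x * Cexp y.
Proof.
destruct x as [a b], y as [c d]; apply injective_projections; simpl;
  rewrite exp_plus, ?cos_plus, ?sin_plus; ring.
Qed.

Lemma Cexp_0 : Cexp 0 = 1.
Proof.
unfold Cexp; simpl; rewrite exp_0, cos_0, sin_0; apply injective_projections; simpl; ring.
Qed.

Lemma Cmod_Cexp (z : C) : Cmod (Cexp z) = exp (Re z).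
Proof.
destruct z as [a b]; unfold Cexp, Cmod; simpl.
replace (_ + _)%R with ((exp a)^2)%R.
- now rewrite sqrt_pow2 by (left; apply exp_pos).
- generalize (sin2_cos2 b); unfold Rsqr; intros H.
  transitivity (exp a ^ 2 * (sin b * sin b + cos b * cos b))%R; [rewrite H|]; ring.
Qed.

Lemma Cexp_neq_1 (z : C) : (0 < Re z)%R -> Cexp z <> 1.
Proof.
intros Hz H; apply (f_equal Cmod) in H; rewrite Cmod_Cexp, Cmod_1 in H.
generalize (exp_increasing _ _ Hz); rewrite exp_0; lra.
Qed.

Lemma Cexp_opp (z : C) : Cexp (- z) = / Cexp z.
Proof.
assert (H : Cexp (- z) * Cexp z = 1).
{ rewrite <- Cexp_plus; replace (- z + z) with (RtoC 0) by ring; apply Cexp_0. }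
assert (Cexp z <> 0).
{ intros E; rewrite E, Cmult_0_r in H; now apply C1_nz. }
rewrite <- (Cmult_1_r (Cexp (- z))), <- (Cinv_r (Cexp z)), Cmult_assoc, H by easy; ring.
Qed.

Lemma Cexp_neq_0 (z : C) : Cexp z <> 0.
Proof.
apply Cmod_gt_0; rewrite Cmod_Cexp; apply exp_pos.
Qed.

Lemma Cexp_RtoC (x : R) : Cexp (RtoC x) = RtoC (exp x).
Proof.
unfold Cexp; simpl; rewrite cos_0, sin_0; apply injective_projections; simpl; ring.
Qed.

Lemma Cexp_PI_Ci : Cexp (RtoC PI * Ci) = - (1).
Proof.
replace (RtoC PI * Ci) with (0, PI) by (apply injective_projections; simpl; ring).
unfold Cexp; simpl; rewrite exp_0, cos_PI, sin_PI; apply injective_projections; simpl; ring.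
Qed.

(** * Moments of [cosh (a u)] and [u sinh (a u)] *)

Definition ccosh (a : C) (u : R) : C := / 2 * Cexp (a * RtoC u) + / 2 * Cexp (- a * RtoC u).
Definition csinh (a : C) (u : R) : C := / 2 * Cexp (a * RtoC u) + - / 2 * Cexp (- a * RtoC u).

Lemma cder_ccosh (a : C) : cder (ccosh a) (fun u => a * csinh a u).
Proof.
eapply cder_ext; [|apply cder_plus; apply cder_scal, cder_Cexp].
intros u; unfold csinh; simpl; ring.
Qed.

Lemma cder_csinh (a : C) : cder (csinh a) (fun u => a * ccosh a u).
Proof.
eapply cder_ext; [|apply cder_plus; apply cder_scal, cder_Cexp].
intros u; unfold ccosh; simpl; ring.
Qed.

Lemma cder_id_csinh (a : C) : cder (fun u => RtoC u * csinh a u) (fun u => csinh a u + a * (RtoC u * ccosh a u)).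
Proof.
eapply cder_ext; [|apply cder_id_mult, cder_csinh].
intros u; simpl; ring.
Qed.

Lemma cder_id_csinh' (a : C) : cder (fun u => csinh a u + a * (RtoC u * ccosh a u))
  (fun u => 2 * a * ccosh a u + a ^ 2 * (RtoC u * csinh a u)).
Proof.
eapply cder_ext; [|apply cder_plus; [apply cder_csinh|apply cder_scal, cder_id_mult, cder_ccosh]].
intros u; simpl; ring.
Qed.

Lemma cder_ccosh' (a : C) : cder (fun u => a * csinh a u) (fun u => a ^ 2 * ccosh a u).
Proof.
eapply cder_ext; [|apply cder_scal, cder_csinh].
intros u; simpl; ring.
Qed.

Lemma csinh_0 (a : C) : csinh a 0 = 0.
Proof. unfold csinh; rewrite !Cmult_0_r; ring. Qed.

Lemma ccosh_0 (a : C) : ccosh a 0 = 1.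
Proof. unfold ccosh; rewrite !Cmult_0_r, Cexp_0; field. Qed.

Lemma ccont_ccosh (a : C) : ccont (ccosh a).
Proof. exact (cder_ccont _ _ (cder_ccosh a)). Qed.

Lemma ccont_id_csinh (a : C) : ccont (fun u => RtoC u * csinh a u).
Proof. exact (cder_ccont _ _ (cder_id_csinh a)). Qed.

Lemma ccont_scal_ccosh (a z : C) : ccont (fun u => z * ccosh a u).
Proof. exact (cder_ccont _ _ (cder_scal z _ _ (cder_ccosh a))). Qed.

Lemma ccont_scal_id_csinh (a z : C) : ccont (fun u => z * (RtoC u * csinh a u)).
Proof. exact (cder_ccont _ _ (cder_scal z _ _ (cder_id_csinh a))). Qed.

Lemma ccont_id_csinh'' (a : C) : ccont (fun u => 2 * a * ccosh a u + a ^ 2 * (RtoC u * csinh a u)).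
Proof.
exact (cder_ccont _ _ (cder_plus _ _ _ _ (cder_scal (2 * a) _ _ (cder_ccosh a))
  (cder_scal (a ^ 2) _ _ (cder_id_csinh a)))).
Qed.

(* Otherwise failing unifications on sums and products in [C] unfold these to real numbers. *)
Opaque cmom ccosh csinh Cexp.

Lemma cmom_ccosh_red (a : C) (n : nat) :
  (a ^ 2 + RtoC (INR (n + 2)) ^ 2) * cmom (n + 2) (ccosh a) =
  RtoC (INR (n + 2)) * RtoC (INR (n + 1)) * cmom n (ccosh a).
Proof.
rewrite <- (cmom_red _ _ _ _ (cder_ccosh a) (cder_ccosh' a)).
- rewrite (cmom_scal _ (a ^ 2) (ccosh a)) by apply ccont_ccosh; ring.
- apply ccont_scal_ccosh.
- rewrite csinh_0; ring.
Qed.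

(** The second derivative of [u sinh (a u)] is [a^2] times itself plus [2 a cosh (a u)]. So the
    recursion is that of [cosh (a u)] with one extra term, a multiple of the moment of [cosh (a u)];
    after division by that moment the extra term becomes one partial fraction. *)
Lemma cmom_id_csinh_red (a : C) (n : nat) :
  2 * a * cmom (n + 2) (ccosh a)
  + (a ^ 2 + RtoC (INR (n + 2)) ^ 2) * cmom (n + 2) (fun u => RtoC u * csinh a u) =
  RtoC (INR (n + 2)) * RtoC (INR (n + 1)) * cmom n (fun u => RtoC u * csinh a u).
Proof.
assert (H0 : csinh a 0 + a * (0%R * ccosh a 0) = 0) by (rewrite csinh_0; ring).
assert (E := cmom_red n _ _ _ (cder_id_csinh a) (cder_id_csinh' a) (ccont_id_csinh'' a) H0).
rewrite (cmom_plus _ _ _ (ccont_scal_ccosh a (2 * a)) (ccont_scal_id_csinh a (a ^ 2))) in E.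
rewrite (cmom_scal _ (2 * a) _ (ccont_ccosh a)) in E.
rewrite (cmom_scal _ (a ^ 2) _ (ccont_id_csinh a)) in E.
etransitivity; [|exact E]; ring.
Qed.

Lemma cmom_ccosh_0 (a : C) : a ^ 2 * cmom 0 (ccosh a) = a * csinh a (PI / 2).
Proof.
rewrite <- (cmom_scal _ (a ^ 2) (ccosh a)) by apply ccont_ccosh.
rewrite (cmom_0 _ _ (cder_ccosh' a)).
- rewrite csinh_0; ring.
- apply ccont_scal_ccosh.
Qed.

(** For [n = 0] the weight is 1, so the second derivative of [u sinh (a u)] integrates to boundary
    values of the first. *)
Lemma cmom_id_csinh_0 (a : C) :
  2 * a * cmom 0 (ccosh a) + a ^ 2 * cmom 0 (fun u => RtoC u * csinh a u) =
  csinh a (PI / 2) + a * (RtoC (PI / 2) * ccosh a (PI / 2)).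
Proof.
rewrite <- (cmom_scal _ (2 * a) (ccosh a)) by apply ccont_ccosh.
rewrite <- (cmom_scal _ (a ^ 2) (fun u => RtoC u * csinh a u)) by apply ccont_id_csinh.
rewrite <- (cmom_plus _ _ _ (ccont_scal_ccosh a (2 * a)) (ccont_scal_id_csinh a (a ^ 2))).
rewrite (cmom_0 _ _ (cder_id_csinh' a)).
- rewrite csinh_0; ring.
- apply ccont_id_csinh''.
Qed.

(* Both [ccosh a u - 1] and [u * csinh a u] are [O(u^2)], and [int u^2 cos^n u = O(W_n / n)]. *)
Lemma cmom_ratio_le (a : C) : exists K : R, eventually (fun n : nat =>
  cmom n (ccosh a) <> 0 /\
  (Cmod (cmom n (fun u => RtoC u * csinh a u) / cmom n (ccosh a))%C <= K / INR (n + 2))%R).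
Proof.
destruct (cmom_quadratic_le _ _ _ (cder_id_csinh a) (cder_id_csinh' a)) as [K1 H1].
{ apply ccont_id_csinh''. }
{ ring. }
{ rewrite csinh_0; ring. }
destruct (cmom_quadratic_le (fun u => ccosh a u + - (1)) (fun u => a * csinh a u + 0)
   (fun u => a ^ 2 * ccosh a u + 0)) as [K2 H2].
{ apply cder_plus; [apply cder_ccosh|apply cder_const]. }
{ apply cder_plus; [apply cder_ccosh'|apply cder_const]. }
{ exact (cder_ccont _ _ (cder_plus _ _ _ _ (cder_scal (a ^ 2) _ _ (cder_ccosh a)) (cder_const 0))). }
{ rewrite ccosh_0; ring. }
{ rewrite csinh_0; ring. }
exists (2 * K1)%R.
(* From [n0] on, [K2 / (n + 2) <= 1 / 2], so the moment of [cosh (a u)] differs from [W] by at most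
   [W / 2]; this keeps the denominator at least [W / 2]. *)
destruct (nfloor_ex (Rabs (2 * K2)) (Rabs_pos _)) as [n0 [_ Hn0]].
exists n0; intros n Hn.
assert (Hp : (2 * K2 < INR (n + 2))%R).
{ apply Rle_lt_trans with (1 := Rle_abs _).
  apply Rlt_le_trans with (1 := Hn0); rewrite <- S_INR; apply le_INR; lia. }
assert (Hpos : (0 < INR (n + 2))%R) by (apply lt_0_INR; lia).
specialize (H1 n); specialize (H2 n).
assert (HW := cosmom_1_pos n).
set (W := cosmom n (fun _ => 1%R)) in *.
assert (E : cmom n (fun u => ccosh a u + - (1)) = cmom n (ccosh a) + - RtoC W).
{ rewrite (cmom_plus _ (ccosh a) (fun _ => - (1))).
  - now rewrite cmom_m1.
  - apply ccont_ccosh.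
  - exact (cder_ccont _ _ (cder_const _)). }
rewrite E in H2.
assert (HI : (W / 2 <= Cmod (cmom n (ccosh a)))%R).
{ assert (HT := Cmod_triangle (cmom n (ccosh a)) (- (cmom n (ccosh a) + - RtoC W))).
  replace (cmom n (ccosh a) + - (cmom n (ccosh a) + - RtoC W)) with (RtoC W) in HT by ring.
  rewrite Cmod_opp, Cmod_R, Rabs_pos_eq in HT by lra.
  assert (K2 * W / INR (n + 2) <= W / 2)%R.
  { apply (Rmult_le_reg_r (INR (n + 2))); [easy|].
    replace (K2 * W / INR (n + 2) * INR (n + 2))%R with (K2 * W)%R by (field; lra). nra. }
  lra. }
assert (HI0 : cmom n (ccosh a) <> 0) by (apply Cmod_gt_0; lra).
split; [easy|].
rewrite Cmod_div by easy.
apply (Rmult_le_reg_r (Cmod (cmom n (ccosh a)))); [lra|].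
unfold Rdiv at 1; rewrite Rmult_assoc, Rinv_l, Rmult_1_r by lra.
assert (HK1 : (0 <= K1 / INR (n + 2))%R).
{ apply (Rmult_le_reg_r W); [easy|].
  replace (K1 / INR (n + 2) * W)%R with (K1 * W / INR (n + 2))%R by (unfold Rdiv; ring).
  rewrite Rmult_0_l; eapply Rle_trans; [apply Cmod_ge_0|exact H1]. }
apply Rle_trans with (1 := H1).
replace (K1 * W / INR (n + 2))%R with (K1 / INR (n + 2) * W)%R by (unfold Rdiv; ring).
replace (2 * K1 / INR (n + 2) * Cmod (cmom n (ccosh a)))%R
 with (K1 / INR (n + 2) * (2 * Cmod (cmom n (ccosh a))))%R by (unfold Rdiv; ring).
apply Rmult_le_compat_l; lra.
Qed.

Transparent cmom ccosh csinh Cexp.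

Lemma Csquare_plus_factor (w z : C) : w ^ 2 + z ^ 2 = (w + Ci * z) * (w - Ci * z).
Proof.
transitivity (w ^ 2 - (Ci * Ci) * z ^ 2); [|ring].
replace (Ci * Ci) with (- (1)) by (apply injective_projections; simpl; ring); ring.
Qed.

Lemma Csquare_plus_neq_0 (w : C) (r : R) : (0 < Re w)%R -> w ^ 2 + RtoC r ^ 2 <> 0.
Proof.
intros Hw E.
rewrite Csquare_plus_factor in E; revert E; apply Cmult_neq_0; intros E; apply (f_equal Re) in E;
  destruct w; simpl in *; lra.
Qed.

(** * Partial fractions of the hyperbolic cotangent *)

Ltac eq_in_C := match goal with |- ?x = ?y => change (@eq C x y) end.

Lemma INR_C_neq_0 (n : nat) : (0 < n)%nat -> RtoC (INR n) <> 0.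
Proof. intros Hn E; apply RtoC_inj in E; apply (not_0_INR n); [lia|easy]. Qed.

Lemma Re_pos_neq_0 (w : C) : (0 < Re w)%R -> w <> 0.
Proof. intros Hw ->; simpl in Hw; lra. Qed.

Lemma C2_neq_0 : RtoC 2 <> 0.
Proof. intros E; apply RtoC_inj in E; lra. Qed.

(** A zero at [N = 0] would mean [sinh (a PI / 2) = 0], that is [e^(a PI) = 1], although this
    exponential has modulus greater than 1. The recursion carries a zero at [S N] back to one at
    [N]. *)
Lemma cmom_ccosh_neq_0 (a : C) (N : nat) : (0 < Re a)%R -> cmom (2 * N) (ccosh a) <> 0.
Proof.
intros Ha; assert (Ha0 := Re_pos_neq_0 _ Ha).
induction N as [|N IH].
- intros E; assert (H := cmom_ccosh_0 a); simpl Nat.mul in E; rewrite E in H.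
  assert (Hs : csinh a (PI / 2) = 0).
  { replace (csinh a (PI / 2)) with (/ a * (a * csinh a (PI / 2))) by (field; easy).
    rewrite <- H; ring. }
  assert (HPI := PI_RGT_0).
  assert (Hp : (0 < Re (2 * (a * RtoC (PI / 2))))%R).
  { destruct a; simpl in *; nra. }
  apply (Cexp_neq_1 _ Hp).
  replace (2 * (a * RtoC (PI / 2))) with (a * RtoC (PI / 2) + a * RtoC (PI / 2)) by ring.
  rewrite Cexp_plus; revert Hs; unfold csinh.
  replace (- a * RtoC (PI / 2)) with (- (a * RtoC (PI / 2))) by ring.
  rewrite Cexp_opp; set (e := Cexp _); assert (e <> 0) by apply Cexp_neq_0.
  intros Hs.
  replace (e * e) with (2 * e * (/ 2 * e + - / 2 * / e) + 1)
    by (field; easy).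
  rewrite Hs; ring.
- intros E; apply IH.
  assert (H := cmom_ccosh_red a (2 * N)).
  replace (2 * S N)%nat with (2 * N + 2)%nat in E by lia.
  rewrite E, Cmult_0_r in H.
  assert (H1 : RtoC (INR (2 * N + 2)) <> 0) by (apply INR_C_neq_0; lia).
  assert (H2 : RtoC (INR (2 * N + 1)) <> 0) by (apply INR_C_neq_0; lia).
  set (z := cmom (2 * N) (ccosh a)) in *.
  replace z with (/ RtoC (INR (2 * N + 2)) * / RtoC (INR (2 * N + 1))
    * (RtoC (INR (2 * N + 2)) * RtoC (INR (2 * N + 1)) * z)) by (field; easy).
  rewrite <- H; ring.
Qed.

(** Quotient of the two recursions at [a = 2 w]: the factor [c] cancels, [a^2 + (2 N + 2)^2] is
    [4 q] with [q = w^2 + (N + 1)^2], and the extra term contributes [2 a / (4 q) = w / q]. *)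
Lemma cmom_ratio_step (w : C) (N : nat) : (0 < Re w)%R ->
  cmom (2 * N) (fun u => RtoC u * csinh (2 * w) u) / cmom (2 * N) (ccosh (2 * w)) =
  cmom (2 * S N) (fun u => RtoC u * csinh (2 * w) u) / cmom (2 * S N) (ccosh (2 * w))
  + w / (w ^ 2 + RtoC (INR (S N)) ^ 2).
Proof.
intros Hw; set (a := 2 * w).
assert (Ha : (0 < Re a)%R) by (destruct w; simpl in *; lra).
assert (HI := cmom_ccosh_neq_0 a N Ha).
assert (HI' := cmom_ccosh_neq_0 a (S N) Ha).
assert (HR := cmom_ccosh_red a (2 * N)).
assert (HJ := cmom_id_csinh_red a (2 * N)).
replace (2 * N + 2)%nat with (2 * S N)%nat in * by lia.
assert (H1 : RtoC (INR (2 * S N)) <> 0) by (apply INR_C_neq_0; lia).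
assert (H2 : RtoC (INR (2 * N + 1)) <> 0) by (apply INR_C_neq_0; lia).
assert (Hq := Csquare_plus_neq_0 w (INR (S N)) Hw).
assert (E2 : RtoC (INR (2 * S N)) = 2 * RtoC (INR (S N)))
  by (rewrite mult_INR, RtoC_mult; reflexivity).
set (c := RtoC (INR (2 * S N)) * RtoC (INR (2 * N + 1))) in *.
assert (Hc : c <> 0) by (now apply Cmult_neq_0).
assert (Eq : a ^ 2 + RtoC (INR (2 * S N)) ^ 2 = 4 * (w ^ 2 + RtoC (INR (S N)) ^ 2))
  by (rewrite E2; unfold a; ring).
rewrite Eq in HR, HJ.
set (I0 := cmom (2 * N) (ccosh a)) in *.
set (J0 := cmom (2 * N) (fun u => RtoC u * csinh a u)) in *.
set (I1 := cmom (2 * S N) (ccosh a)) in *.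
set (J1 := cmom (2 * S N) (fun u => RtoC u * csinh a u)) in *.
set (q := w ^ 2 + RtoC (INR (S N)) ^ 2) in *.
replace (J0 / I0) with ((c * J0) / (c * I0)) by (field; easy).
rewrite <- HJ, <- HR; unfold a; field.
repeat split; try easy; intros E; apply RtoC_inj in E; lra.
Qed.

(** The value is [(PI / 2) coth (PI w) - 1 / (2 w)], with the hyperbolic cotangent written in the
    exponential form that occurs in [S_fun]. *)
Lemma cmom_ratio_0 (w : C) : (0 < Re w)%R ->
  cmom 0 (fun u => RtoC u * csinh (2 * w) u) / cmom 0 (ccosh (2 * w)) =
  RtoC PI * (/ (Cexp (2 * RtoC PI * w) - 1) + / 2) - / (2 * w).
Proof.
intros Hw; set (a := 2 * w).
assert (Hw0 := Re_pos_neq_0 _ Hw).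
assert (Ha : (0 < Re a)%R) by (destruct w; simpl in *; lra).
assert (Ha0 := Re_pos_neq_0 _ Ha).
assert (HI : cmom 0 (ccosh a) <> 0) by apply (cmom_ccosh_neq_0 a 0 Ha).
assert (H0 := cmom_ccosh_0 a); assert (H1 := cmom_id_csinh_0 a).
set (I0 := cmom 0 (ccosh a)) in *.
set (J0 := cmom 0 (fun u => RtoC u * csinh a u)) in *.
assert (HPI := PI_RGT_0).
assert (Hp : (0 < Re (2 * RtoC PI * w))%R) by (destruct w; simpl in *; nra).
assert (Hx := Cexp_neq_1 _ Hp); revert Hx.
replace (2 * RtoC PI * w) with (w * RtoC PI + w * RtoC PI) by ring.
rewrite Cexp_plus; unfold csinh, ccosh in H0, H1.
replace (- a * RtoC (PI / 2)) with (- (w * RtoC PI)) in *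
  by (unfold a; rewrite RtoC_div by lra; field; apply C2_neq_0).
replace (a * RtoC (PI / 2)) with (w * RtoC PI) in *
  by (unfold a; rewrite RtoC_div by lra; field; apply C2_neq_0).
rewrite Cexp_opp in H0, H1.
assert (He := Cexp_neq_0 (w * RtoC PI)); set (e := Cexp (w * RtoC PI)) in *.
intros Hx.
assert (Hx' : e * e - 1 <> 0) by now apply Cminus_eq_contra.
rewrite RtoC_div in H1 by lra.
assert (E0 : I0 = (e * e - 1) / (2 * e * a)).
{ replace I0 with (a ^ 2 * I0 / a ^ 2) by (field; easy).
  rewrite H0; field; repeat split; try easy; apply C2_neq_0. }
assert (E1 : J0 = ((/ 2 * e + - / 2 * / e + a * (RtoC PI / 2 * (/ 2 * e + / 2 * / e))) - 2 * a * I0) / a ^ 2).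
{ rewrite <- H1; field; easy. }
rewrite E1, E0; unfold a; field; repeat split; try easy; apply C2_neq_0.
Qed.

(** By [cmom_ratio_step] the series times [w] telescopes to [r 0 - r (S N)], and [cmom_ratio_le]
    makes the remainder [O(1/N)]. *)
Lemma is_Cseries_partial_fractions (w : C) : (0 < Re w)%R ->
  is_Cseries (fun l => / (w ^ 2 + RtoC (INR (S l)) ^ 2))
    (/ w * (RtoC PI * (/ (Cexp (2 * RtoC PI * w) - 1) + / 2) - / (2 * w))).
Proof.
intros Hw; rewrite <- cmom_ratio_0 by easy.
assert (Hw0 := Re_pos_neq_0 _ Hw).
set (r := fun N => cmom (2 * N) (fun u => RtoC u * csinh (2 * w) u) / cmom (2 * N) (ccosh (2 * w))).
change (is_Cseries (fun l => / (w ^ 2 + RtoC (INR (S l)) ^ 2)) (/ w * r 0%nat)).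
destruct (cmom_ratio_le (2 * w)) as [K [n0 HK]].
assert (HS : forall N, sum_n (G := C_AbelianMonoid)
   (fun l => / (w ^ 2 + RtoC (INR (S l)) ^ 2)) N = / w * (r 0%nat - r (S N))).
{ intros N; induction N as [|N IH].
  - rewrite sum_O; unfold r at 1; rewrite (cmom_ratio_step w 0 Hw).
    fold (r 1%nat); eq_in_C; field; split; (exact Hw0 || now apply Csquare_plus_neq_0).
  - rewrite sum_Sn, IH; assert (E := cmom_ratio_step w (S N) Hw).
    fold (r (S N)) (r (S (S N))) in E; rewrite E.
    eq_in_C; change (@plus C_AbelianMonoid) with Cplus.
    field; split; (exact Hw0 || now apply Csquare_plus_neq_0). }
apply (is_Cseries_of_bound _ _ (fun N => (/ Cmod w * K) * / INR (2 * N + 4))%R).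
- exists n0; intros N HN; rewrite HS.
  destruct (HK (2 * S N)%nat ltac:(lia)) as [_ H].
  fold (r (S N)) in H.
  replace (/ w * (r 0%nat - r (S N)) - / w * r 0%nat) with (- (/ w * r (S N))) by ring.
  rewrite Cmod_opp, Cmod_mult, Cmod_inv, Rmult_assoc by easy.
  apply Rmult_le_compat_l.
  + left; apply Rinv_0_lt_compat, Cmod_gt_0, Hw0.
  + replace (2 * N + 4)%nat with (2 * S N + 2)%nat by lia; exact H.
- replace (Finite 0) with (Rbar_mult (Finite (/ Cmod w * K)%R) (Finite 0%R)) by (simpl; f_equal; ring).
  apply is_lim_seq_scal_l.
  apply (is_lim_seq_subseq (fun n => / INR n)%R (Finite 0%R) (fun N => (2 * N + 4)%nat)).
  + apply eventually_subseq; intros n; lia.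
  + apply is_lim_seq_inv with (l := p_infty); [apply is_lim_seq_INR|easy].
Qed.

Open Scope R_scope.

(** * Exchange of summations *)

Lemma sum_n_R_Sn (v : nat -> R) (n : nat) : sum_n v (S n) = sum_n v n + v (S n).
Proof. exact (sum_Sn v n). Qed.

Lemma minus_plus_plus {G : AbelianGroup} (a b c d : G) :
  plus (minus a c) (minus b d) = minus (plus a b) (plus c d).
Proof.
unfold minus; rewrite opp_plus, <- !plus_assoc; f_equal.
rewrite !plus_assoc; f_equal; apply plus_comm.
Qed.

Section Swap.
Context {K : AbsRing} {V : NormedModule K}.

(** The bound is first shown between the partial sums at [N] and [N + k], by induction on [k]; then
    [k] tends to infinity. *)
Lemma is_series_tail_le (x : nat -> V) (y : V) (v : nat -> R) (s t : R) :
  0 <= t -> (forall n, norm (x n) <= t * v n) -> (forall n, 0 <= v n) ->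
  is_series x y -> is_series v s ->
  forall N, norm (minus y (sum_n x N)) <= t * (s - sum_n v N).
Proof.
intros Ht Hx Hv Sx Sv N.
assert (Hk : forall k, norm (minus (sum_n x (N + k)) (sum_n x N)) <=
   t * (sum_n v (N + k) - sum_n v N)).
{ intros k; induction k as [|k IH].
  - rewrite Nat.add_0_r, minus_eq_zero; right; rewrite Rminus_diag, Rmult_0_r; apply norm_zero.
  - rewrite Nat.add_succ_r, sum_n_R_Sn, sum_Sn.
    replace (minus (plus (sum_n x (N + k)) (x (S (N + k)))) (sum_n x N))
      with (plus (minus (sum_n x (N + k)) (sum_n x N)) (x (S (N + k)))).
    + eapply Rle_trans; [apply norm_triangle|].
      specialize (Hx (S (N + k))); lra.
    + unfold minus; rewrite <- !plus_assoc; f_equal; apply plus_comm. }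
assert (Hs : forall k, sum_n v (N + k) <= s).
{ intros k; apply (is_lim_seq_incr_compare (sum_n v)); [exact Sv|].
  intros n; rewrite sum_n_R_Sn; specialize (Hv (S n)); lra. }
assert (HL : is_lim_seq (fun k => norm (minus (sum_n x (k + N)) (sum_n x N)))
   (norm (minus y (sum_n x N)))).
{ apply (filterlim_comp _ _ _ (fun k => minus (sum_n x (k + N)) (sum_n x N)) norm _
    (locally (minus y (sum_n x N)))); [|apply filterlim_norm].
  apply (filterlim_comp_2 (G := locally y) (H := locally (opp (sum_n x N)))
   (fun k => sum_n x (k + N)) (fun _ => opp (sum_n x N)) plus).
  - apply (filterlim_comp _ _ _ (fun k => (k + N)%nat) (sum_n x) _ eventually); [|exact Sx].
    apply eventually_subseq; intros; lia.
  - apply filterlim_const.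
  - apply (filterlim_plus y). }
refine (is_lim_seq_le _ (fun _ => t * (s - sum_n v N)) _ (Finite (t * (s - sum_n v N))) _ HL _).
- intros k; rewrite Nat.add_comm; eapply Rle_trans; [apply Hk|].
  apply Rmult_le_compat_l; [easy|]; specialize (Hs k); lra.
- apply is_lim_seq_const.
Qed.

Lemma norm_sum_n_minus_le (b d : nat -> V) (u : nat -> R) (t : R) :
  (forall n, norm (minus (b n) (d n)) <= u n * t) ->
  forall N, norm (minus (sum_n b N) (sum_n d N)) <= sum_n u N * t.
Proof.
intros H N; induction N as [|N IH].
- rewrite !sum_O; apply H.
- rewrite sum_n_R_Sn, !sum_Sn.
  replace (minus (plus (sum_n b N) (b (S N))) (plus (sum_n d N) (d (S N))))
    with (plus (minus (sum_n b N) (sum_n d N)) (minus (b (S N)) (d (S N)))).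
  + eapply Rle_trans; [apply norm_triangle|].
    specialize (H (S N)); lra.
  + exact (minus_plus_plus (G := NormedModule.AbelianGroup K V) _ _ _ _).
Qed.

Lemma norm_square_sum_le (a : nat -> nat -> V) (u v : nat -> R) (b : nat -> V) (U W : R) :
  (forall n l, norm (a n l) <= u n * v l) -> (forall n, 0 <= u n) -> (forall l, 0 <= v l) ->
  is_series u U -> is_series v W -> (forall n, is_series (a n) (b n)) ->
  forall N, norm (minus (sum_n b N) (sum_n (fun n => sum_n (a n) N) N)) <= U * (W - sum_n v N).
Proof.
intros Ha Hu Hv HU HW Hb N.
assert (Ht : 0 <= W - sum_n v N).
{ assert (sum_n v N <= W); [|lra].
  apply (is_lim_seq_incr_compare (sum_n v)); [exact HW|].
  intros n; rewrite sum_n_R_Sn; specialize (Hv (S n)); lra. }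
eapply Rle_trans; [apply (norm_sum_n_minus_le _ _ u)|].
- intros n; exact (is_series_tail_le _ _ v W (u n) (Hu n) (Ha n) Hv (Hb n) HW N).
- apply Rmult_le_compat_r; [easy|].
  apply (is_lim_seq_incr_compare (sum_n u)); [exact HU|].
  intros n; rewrite sum_n_R_Sn; specialize (Hu (S n)); lra.
Qed.

(** Both orders of summation share the square partial sums. By [norm_square_sum_le] each iterated
    sum is off by at most the total of one dominating series times the tail of the other, which
    tends to 0. So convergence of the column sums is a conclusion, drawn from that of the row
    sums. *)
Lemma is_series_swap (a : nat -> nat -> V) (u v : nat -> R) (b c : nat -> V) (s : V) :
  (forall n l, norm (a n l) <= u n * v l) -> (forall n, 0 <= u n) -> (forall l, 0 <= v l) ->
  ex_series u -> ex_series v ->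
  (forall n, is_series (a n) (b n)) -> (forall l, is_series (fun n => a n l) (c l)) ->
  is_series b s -> is_series c s.
Proof.
intros Ha Hu Hv [U HU] [W HW] Hb Hc Hs.
assert (H1 := norm_square_sum_le a u v b U W Ha Hu Hv HU HW Hb).
assert (H2 := norm_square_sum_le (fun l n => a n l) v u c W U
   (fun l n => eq_rect _ (Rle _) (Ha n l) _ (Rmult_comm _ _)) Hv Hu HW HU Hc).
apply filterlim_locally_ball_norm; intros eps.
assert (H3 := proj1 (filterlim_locally_ball_norm _ _) Hs (pos_div_2 eps)).
assert (HT : is_lim_seq (fun N => U * (W - sum_n v N) + W * (U - sum_n u N)) 0).
{ replace (Finite 0) with (Finite (U * (W - W) + W * (U - U))) by (f_equal; ring).
  apply is_lim_seq_plus'; (apply (is_lim_seq_scal_l _ _ (Finite (_ - _))));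
   (apply is_lim_seq_minus'; [apply is_lim_seq_const|assumption]). }
apply is_lim_seq_spec in HT; specialize (HT (pos_div_2 eps)).
generalize (filter_and _ _ H3 HT); apply filter_imp; intros N [H4 H5].
unfold ball_norm in *.
set (D := sum_n (fun n => sum_n (a n) N) N) in *.
specialize (H1 N); specialize (H2 N).
assert (ED : sum_n (fun l => sum_n (fun n => a n l) N) N = D)
  by apply (sum_n_switch (fun l n => a n l)).
rewrite ED in H2.
replace (minus (sum_n c N) s) with (plus (minus (sum_n c N) D)
  (plus (minus D (sum_n b N)) (minus (sum_n b N) s))).
- assert (T1 := norm_triangle (minus (sum_n c N) D)
     (plus (minus D (sum_n b N)) (minus (sum_n b N) s))).
  assert (T2 := norm_triangle (minus D (sum_n b N)) (minus (sum_n b N) s)).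
  assert (T3 : norm (minus D (sum_n b N)) = norm (minus (sum_n b N) D))
    by (rewrite <- norm_opp, opp_minus; easy).
  rewrite Rminus_0_r in H5; apply Rle_lt_trans with (1 := Rle_abs _) in H5.
  assert (aux : forall p q x y y' z A B e : R, p <= x + q -> q <= y' + z -> y' = y ->
    y <= A -> x <= B -> A + B < e / 2 -> z < e / 2 -> p < e) by (intros; lra).
  exact (aux _ _ _ _ _ _ _ _ _ T1 T2 T3 H1 H2 H5 H4).
- symmetry; etransitivity; [exact (minus_trans (G := NormedModule.AbelianGroup K V) D _ _)|].
  f_equal; exact (minus_trans (G := NormedModule.AbelianGroup K V) (sum_n b N) _ _).
Qed.
End Swap.

(** * Zeta values at even integers *)

Definition partial_fractions_R (z : R) : R :=
  / z * (PI * (/ (exp (2 * PI * z) - 1) + / 2) - / (2 * z)).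

Lemma exp_neq_1 (x : R) : x <> 0 -> exp x <> 1.
Proof. intros Hx E; apply Hx, exp_inv; now rewrite E, exp_0. Qed.

(** Carries the expansion to negative [z]: Taylor coefficients at 0 are compared later, on a
    neighbourhood with both signs. *)
Lemma partial_fractions_R_even (z : R) : z <> 0 ->
  partial_fractions_R (- z) = partial_fractions_R z.
Proof.
intros Hz; unfold partial_fractions_R; assert (HPI := PI_RGT_0).
replace (2 * PI * - z) with (- (2 * PI * z)) by ring; rewrite exp_Ropp.
assert (Hx : exp (2 * PI * z) <> 1) by (apply exp_neq_1; nra).
assert (He := exp_pos (2 * PI * z)).
set (e := exp _) in *; field; repeat split; lra.
Qed.

Lemma is_series_partial_fractions_R (z : R) : z <> 0 ->
  is_series (fun l => / (z ^ 2 + INR (S l) ^ 2)) (partial_fractions_R z).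
Proof.
assert (Hpos : forall z, 0 < z ->
  is_series (fun l => / (z ^ 2 + INR (S l) ^ 2)) (partial_fractions_R z)).
{ clear z; intros z Hz; assert (HPI := PI_RGT_0).
  assert (H := is_Cseries_Re _ _ (is_Cseries_partial_fractions (RtoC z) Hz)).
  assert (Hx : exp (2 * PI * z) <> 1) by (apply exp_neq_1; nra).
  match goal with |- is_series _ ?v => replace v with (Re (/ RtoC z *
     (RtoC PI * (/ (Cexp (2 * RtoC PI * RtoC z) - 1) + / 2) - / (2 * RtoC z))))%C end.
  - revert H; apply is_series_ext; intros l.
    rewrite <- !RtoC_pow, <- RtoC_plus, <- RtoC_inv; [easy|].
    assert (0 < z ^ 2) by (apply pow_lt; lra); generalize (pow2_ge_0 (INR (S l))); lra.
  - rewrite <- !RtoC_mult, Cexp_RtoC, <- RtoC_minus, <- !RtoC_inv, <- RtoC_plus, <- !RtoC_mult,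
      <- RtoC_minus, <- RtoC_mult by lra; easy. }
intros Hz; destruct (Rtotal_order z 0) as [Hn|[H0|Hp]]; [|easy|now apply Hpos].
rewrite <- partial_fractions_R_even by easy.
apply (is_series_ext (fun l => / ((- z) ^ 2 + INR (S l) ^ 2))).
- intros l; f_equal; ring.
- apply Hpos; lra.
Qed.

Definition zetaR (k : nat) : R := Series (fun n => / INR (S n) ^ k).

Lemma INR_S_ge_1 (n : nat) : 1 <= INR (S n).
Proof. rewrite S_INR; generalize (pos_INR n); lra. Qed.

Lemma ex_series_inv_pow (k : nat) : (2 <= k)%nat -> ex_series (fun n => / INR (S n) ^ k).
Proof.
intros Hk.
(* The expansion at [z = 1] is a convergent series already at hand, and
   [1 / x^k <= 1 / x^2 <= 2 / (1 + x^2)] for [x >= 1]. *)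
apply (ex_series_le (V := R_CompleteNormedModule) _ (fun n => 2 * / (1 ^ 2 + INR (S n) ^ 2))).
- intros n; change norm with Rabs; assert (H := INR_S_ge_1 n).
  set (x := INR (S n)) in *.
  assert (H2 : x ^ 2 <= x ^ k) by (apply Rle_pow; [lra|lia]).
  assert (H1 : 1 <= x ^ 2) by nra.
  rewrite Rabs_pos_eq by (left; apply Rinv_0_lt_compat; lra).
  apply Rle_trans with (/ x ^ 2); [apply Rinv_le_contravar; lra|].
  apply (Rmult_le_reg_r (x ^ 2 * (1 ^ 2 + x ^ 2))); [nra|].
  replace (/ x ^ 2 * (x ^ 2 * (1 ^ 2 + x ^ 2))) with (1 + x ^ 2) by (field; lra).
  replace (2 * / (1 ^ 2 + x ^ 2) * (x ^ 2 * (1 ^ 2 + x ^ 2))) with (2 * x ^ 2) by (field; lra).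
  lra.
- eexists; apply (is_series_scal (K := R_AbsRing) (V := R_NormedModule) 2).
  apply (is_series_partial_fractions_R 1); lra.
Qed.

Lemma is_series_zetaR (k : nat) : (2 <= k)%nat ->
  is_series (fun n => / INR (S n) ^ k) (zetaR k).
Proof. intros Hk; now apply Series_correct, ex_series_inv_pow. Qed.

(** Each fraction [1 / (z^2 + x^2)] is a geometric series of ratio [- z^2 / x^2]. Summing over [x]
    first leaves zeta values; the products [x^(-2) (z^2)^j] dominate, with [x >= 1] and
    [z^2 < 1]. *)
Lemma is_series_partial_fractions_zeta (z : R) : z <> 0 -> Rabs z < 1 ->
  is_series (fun j => (-1) ^ j * zetaR (2 * j + 2) * (z ^ 2) ^ j) (partial_fractions_R z).
Proof.
intros Hz0 Hz1.
assert (Hz2 : 0 <= z ^ 2 < 1).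
{ split; [apply pow2_ge_0|].
  rewrite <- Rsqr_pow2, Rsqr_abs; unfold Rsqr; generalize (Rabs_pos z); nra. }
refine (is_series_swap (K := R_AbsRing) (V := R_NormedModule)
  (fun l j => (-1) ^ j * (z ^ 2) ^ j * / INR (S l) ^ (2 * j + 2))
  (fun l => / INR (S l) ^ 2) (fun j => (z ^ 2) ^ j)
  (fun l => / (z ^ 2 + INR (S l) ^ 2)) _ _ _ _ _ _ _ _ _ _).
- intros l j; change norm with Rabs; assert (H := INR_S_ge_1 l); set (x := INR (S l)) in *.
  rewrite !Rabs_mult, pow_1_abs, Rmult_1_l.
  assert (Hx : 0 < / x ^ (2 * j + 2)) by (apply Rinv_0_lt_compat, pow_lt; lra).
  rewrite (Rabs_pos_eq (/ _)), (Rabs_pos_eq ((z ^ 2) ^ j)) by (lra || now apply pow_le).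
  rewrite Rmult_comm; apply Rmult_le_compat_r; [now apply pow_le|].
  apply Rinv_le_contravar; [apply pow_lt; lra|apply Rle_pow; [lra|lia]].
- intros l; left; apply Rinv_0_lt_compat, pow_lt; generalize (INR_S_ge_1 l); lra.
- intros j; now apply pow_le.
- apply ex_series_inv_pow; lia.
- apply ex_series_geom; rewrite Rabs_pos_eq; lra.
- intros l; assert (H := INR_S_ge_1 l); set (x := INR (S l)) in *.
  assert (H1 : 1 <= x ^ 2) by nra.
  assert (Hq : Rabs (- (z ^ 2 / x ^ 2)) < 1).
  { rewrite Rabs_Ropp, Rabs_pos_eq.
    - apply (Rmult_lt_reg_r (x ^ 2)); [lra|].
      unfold Rdiv; rewrite Rmult_assoc, Rinv_l by lra; lra.
    - apply Rmult_le_pos; [lra|left; apply Rinv_0_lt_compat; lra]. }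
  replace (/ (z ^ 2 + x ^ 2)) with (/ x ^ 2 * / (1 - - (z ^ 2 / x ^ 2)))
    by (field; split; nra).
  apply (is_series_ext (fun j => / x ^ 2 * (- (z ^ 2 / x ^ 2)) ^ j)).
  + intros j; replace (- (z ^ 2 / x ^ 2)) with (-1 * z ^ 2 * / x ^ 2) by (field; lra).
    rewrite !Rpow_mult_distr, pow_add, pow_mult, pow_inv; change (R_AbsRing : Type) with R.
    match goal with |- ?a = ?b => change (@eq R a b) end.
    assert ((x ^ 2) ^ j <> 0) by (apply pow_nonzero; lra).
    field; lra.
  + apply (is_series_scal (K := R_AbsRing) (V := R_NormedModule)), is_series_geom, Hq.
- intros j.
  apply (is_series_ext (fun l => ((-1) ^ j * (z ^ 2) ^ j) * / INR (S l) ^ (2 * j + 2))).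
  { easy. }
  replace ((-1) ^ j * zetaR (2 * j + 2) * (z ^ 2) ^ j)
    with (((-1) ^ j * (z ^ 2) ^ j) * zetaR (2 * j + 2)) by ring.
  apply (is_series_scal (K := R_AbsRing) (V := R_NormedModule)), is_series_zetaR; lia.
- now apply is_series_partial_fractions_R.
Qed.

(** Taylor coefficients at 0 of [2 PI z / (e^(2 PI z) - 1)], with the even ones expressed by zeta
    values. *)
Definition bern_gen (n : nat) : R :=
  match n with
  | O => 1
  | 1%nat => - PI
  | S (S p) => if Nat.even p then 2 * (-1) ^ (p / 2) * zetaR n else 0
  end.

Lemma is_series_incr (a : nat -> R) (l : R) :
  is_series (fun n => a (S n)) (l - a 0%nat) -> is_series a l.
Proof. intros H; apply is_series_decr_1; exact H. Qed.

Lemma is_pseries_bern_gen (z : R) : z <> 0 -> Rabs z < 1 ->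
  is_pseries bern_gen z (2 * PI * z / (exp (2 * PI * z) - 1)).
Proof.
intros Hz0 Hz1; assert (HPI := PI_RGT_0).
assert (Hx : exp (2 * PI * z) <> 1) by (apply exp_neq_1; intros E; apply Hz0; nra).
(* The definition of [partial_fractions_R] solved for the exponential term: an even function plus
   the single odd term [- PI z]. *)
replace (2 * PI * z / (exp (2 * PI * z) - 1))
  with ((1 + 2 * z ^ 2 * partial_fractions_R z) + z * - PI)
  by (unfold partial_fractions_R; field; lra).
apply is_pseries_odd_even; apply is_pseries_R.
- apply is_series_incr.
  replace (1 + 2 * z ^ 2 * partial_fractions_R z - bern_gen (2 * 0) * (z ^ 2) ^ 0)
   with (2 * z ^ 2 * partial_fractions_R z) by (simpl; ring).
  apply (is_series_ext (fun j => 2 * z ^ 2 * ((-1) ^ j * zetaR (2 * j + 2) * (z ^ 2) ^ j))).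
  + intros j; replace (2 * S j)%nat with (S (S (2 * j))) by lia.
    unfold bern_gen; rewrite Nat.even_mul.
    replace (2 * j / 2)%nat with j by (rewrite Nat.mul_comm, Nat.div_mul; lia).
    replace (S (S (2 * j))) with (2 * j + 2)%nat by lia; simpl orb.
    change (@eq R (2 * z ^ 2 * ((-1) ^ j * zetaR (2 * j + 2) * (z ^ 2) ^ j))
     (2 * (-1) ^ j * zetaR (2 * j + 2) * (z ^ 2) ^ S j)); simpl; ring.
  + apply (is_series_scal (K := R_AbsRing) (V := R_NormedModule)).
    now apply is_series_partial_fractions_zeta.
- apply is_series_incr.
  apply (is_series_ext (fun _ => 0)).
  + intros j; replace (2 * S j + 1)%nat with (S (S (2 * j + 1))) by lia.
    unfold bern_gen; rewrite Nat.even_add, Nat.even_mul; simpl.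
    match goal with |- ?a = ?b => change (@eq R a b) end; ring.
  + simpl. replace (- PI - - PI * 1) with 0 by ring.
    apply (filterlim_ext (fun _ => 0)); [|apply filterlim_const].
    intros n; induction n as [|n IH]; [now rewrite sum_O|].
    transitivity (sum_n (fun _ : nat => 0) n + 0); [rewrite Rplus_0_r; exact IH|].
    symmetry; exact (sum_n_R_Sn _ _).
Qed.

(** Taylor coefficients of the reciprocal function [(e^(2 PI z) - 1) / (2 PI z)]. *)
Definition expm1_gen (n : nat) : R := (2 * PI) ^ n / INR (fact (S n)).

Lemma is_pseries_expm1_gen (z : R) : z <> 0 ->
  is_pseries expm1_gen z ((exp (2 * PI * z) - 1) / (2 * PI * z)).
Proof.
intros Hz; assert (HPI := PI_RGT_0); apply is_pseries_R.
apply (is_series_ext (fun n => / (2 * PI * z) *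
   (/ INR (fact (S n)) * (2 * PI * z) ^ S n))).
- intros n; unfold expm1_gen.
  assert (INR (fact (S n)) <> 0) by apply INR_fact_neq_0.
  change (@eq R (/ (2 * PI * z) * (/ INR (fact (S n)) * ((2 * PI * z) * (2 * PI * z) ^ n)))
    ((2 * PI) ^ n / INR (fact (S n)) * z ^ n)).
  rewrite (Rpow_mult_distr (2 * PI) z n); field; repeat split; lra.
- replace ((exp (2 * PI * z) - 1) / (2 * PI * z))
    with (/ (2 * PI * z) * (exp (2 * PI * z) - 1)) by (unfold Rdiv; ring).
  apply (is_series_scal (K := R_AbsRing) (V := R_NormedModule)).
  apply (is_series_incr_1 (K := R_AbsRing) (V := R_NormedModule)
    (fun n => / INR (fact n) * (2 * PI * z) ^ n)).
  replace (plus _ _) with (exp (2 * PI * z)); [|change plus with Rplus; simpl; field].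
  exact (proj1 (is_pseries_R _ _ _) (is_exp_Reals (2 * PI * z))).
Qed.

Lemma ex_pseries_CV_radius (a : nat -> R) (x l : R) :
  is_pseries a x l -> Rbar_le (Rabs x) (CV_radius a).
Proof.
intros H; apply Rbar_not_lt_le; intros Hlt.
apply (CV_disk_outside _ _ Hlt).
apply ex_series_lim_0; exists l; now apply is_pseries_R.
Qed.

(** The Cauchy product sums to the constant 1 near 0, so its derivatives of positive order at 0
    vanish, and with them the coefficients. *)
Lemma PS_mult_bern_expm1 (n : nat) : PS_mult bern_gen expm1_gen (S n) = 0.
Proof.
assert (HPI := PI_RGT_0).
assert (Hr : forall z, Rabs z <= / 2 ->
  Rbar_lt (Rabs z) (CV_radius bern_gen) /\ Rbar_lt (Rabs z) (CV_radius expm1_gen)).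
(* Convergence at 3/4, a point strictly between 1/2 and 1, puts the points with [|z| <= 1/2]
   strictly inside both disks of convergence. *)
{ intros z Hz; assert (Ha : Rabs (3 / 4) = 3 / 4) by (apply Rabs_pos_eq; lra).
  assert (H0 : Rbar_lt (Rabs z) (Rabs (3 / 4))) by (simpl; lra).
  split; eapply Rbar_lt_le_trans; try exact H0; eapply ex_pseries_CV_radius;
   [apply is_pseries_bern_gen|apply is_pseries_expm1_gen]; lra. }
assert (Hp : forall z, Rabs z <= / 2 -> is_pseries (PS_mult bern_gen expm1_gen) z 1).
{ intros z Hz; destruct (Hr z Hz) as [H1 H2].
  (* The closed forms divide by zero at [z = 0]; there the value comes from the constant
     coefficients. *)
  destruct (Req_dec z 0) as [->|Hz0].
  - replace 1 with (bern_gen 0 * expm1_gen 0) by (unfold expm1_gen; simpl; field).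
    apply is_pseries_mult; try easy; exact (is_pseries_0 _).
  - assert (Hx : exp (2 * PI * z) <> 1) by (apply exp_neq_1; intros E; apply Hz0; nra).
    replace 1 with (2 * PI * z / (exp (2 * PI * z) - 1) * ((exp (2 * PI * z) - 1) / (2 * PI * z)))
      by (field; repeat split; lra).
    apply is_pseries_mult; try easy; [apply is_pseries_bern_gen|apply is_pseries_expm1_gen]; lra. }
assert (Hc : Rbar_lt 0 (CV_radius (PS_mult bern_gen expm1_gen))).
{ apply Rbar_lt_le_trans with (Finite (Rabs (/ 2))).
  - simpl; rewrite Rabs_pos_eq; lra.
  - eapply ex_pseries_CV_radius, Hp; rewrite Rabs_pos_eq; lra. }
assert (H := Derive_n_coef (PS_mult bern_gen expm1_gen) (S n) Hc).
rewrite (Derive_n_ext_loc _ (fun _ => 1)), Derive_n_const in H.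
- symmetry in H; apply Rmult_integral in H; destruct H as [H|H]; [easy|].
  now apply INR_fact_neq_0 in H.
- assert (Hh : 0 < / 2) by lra.
  exists (mkposreal _ Hh); intros z Hz; apply is_pseries_unique, Hp.
  unfold ball in Hz; simpl in Hz; unfold AbsRing_ball, abs, minus, plus, opp in Hz; simpl in Hz.
  rewrite Ropp_0, Rplus_0_r in Hz; lra.
Qed.

(** Multiplied by [(n + 2)!], the vanishing Cauchy coefficient of index [S n] is the relation
    [bernoulli_rec] scaled by [(2 PI)^(S n)]. By strong induction all terms but the last agree, and
    the last ones share a nonzero binomial factor. *)
Lemma bern_gen_bernoulli (n : nat) : bern_gen n * INR (fact n) = (2 * PI) ^ n * bernoulli n.
Proof.
assert (HPI := PI_RGT_0).
induction n as [n IH] using (well_founded_induction lt_wf).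
destruct n as [|n]; [rewrite bernoulli_0; simpl; ring|].
assert (H2 := bernoulli_rec n).
assert (E : PS_mult bern_gen expm1_gen (S n) * INR (fact (n + 2)) = 
  sum_f_R0 (fun k => Binomial.C (n + 2) k * (bern_gen k * INR (fact k)) * (2 * PI) ^ (S n - k)) (S n)).
{ unfold PS_mult; rewrite Rmult_comm, scal_sum; apply sum_eq; intros k Hk.
  unfold expm1_gen, Binomial.C; replace (n + 2 - k)%nat with (S (S n - k)) by lia.
  field; split; apply INR_fact_neq_0. }
assert (H3 := PS_mult_bern_expm1 n); rewrite H3, Rmult_0_l in E; symmetry in E.
assert (E2 : sum_f_R0 (fun k =>
    Binomial.C (n + 2) k * ((2 * PI) ^ k * bernoulli k) * (2 * PI) ^ (S n - k)) (S n) = 0).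
{ replace 0 with ((2 * PI) ^ S n * 0) by ring; rewrite <- H2, scal_sum.
  apply sum_eq; intros k Hk.
  replace ((2 * PI) ^ S n) with ((2 * PI) ^ k * (2 * PI) ^ (S n - k))
    by (rewrite <- pow_add; f_equal; lia); ring. }
rewrite tech5 in E, E2.
rewrite (sum_eq _ (fun k => Binomial.C (n + 2) k * ((2 * PI) ^ k * bernoulli k) * (2 * PI) ^ (S n - k)))
  in E by (intros k Hk; rewrite IH by lia; easy).
rewrite Nat.sub_diag, pow_O, !Rmult_1_r in E, E2.
assert (HC : 0 < Binomial.C (n + 2) (S n)).
{ unfold Binomial.C; apply Rdiv_lt_0_compat; [apply INR_fact_lt_0|].
  apply Rmult_lt_0_compat; apply INR_fact_lt_0. }
apply (Rmult_eq_reg_l (Binomial.C (n + 2) (S n))); lra.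
Qed.

Lemma zetaR_even (j : nat) :
  2 * (-1) ^ j * zetaR (2 * j + 2) * INR (fact (2 * j + 2)) =
  (2 * PI) ^ (2 * j + 2) * bernoulli (2 * j + 2).
Proof.
rewrite <- bern_gen_bernoulli; f_equal.
replace (2 * j + 2)%nat with (S (S (2 * j))) by lia; unfold bern_gen.
rewrite Nat.even_mul; simpl orb.
now replace (2 * j / 2)%nat with j by (rewrite Nat.mul_comm, Nat.div_mul; lia).
Qed.

Open Scope C_scope.

(** * The modular relation *)

Lemma is_Cseries_ext (a b : nat -> C) (l : C) :
  (forall n, a n = b n) -> is_Cseries a l -> is_Cseries b l.
Proof. apply is_series_ext. Qed.

Lemma is_Cseries_plus (a b : nat -> C) (la lb : C) :
  is_Cseries a la -> is_Cseries b lb -> is_Cseries (fun n => a n + b n) (la + lb).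
Proof. apply (is_series_plus (K := C_AbsRing) (V := C_NormedModule)). Qed.

Lemma is_Cseries_scal (c : C) (a : nat -> C) (l : C) :
  is_Cseries a l -> is_Cseries (fun n => c * a n) (c * l).
Proof. apply (is_series_scal (K := C_AbsRing) (V := C_NormedModule)). Qed.

Lemma is_Cseries_minus (a b : nat -> C) (la lb : C) :
  is_Cseries a la -> is_Cseries b lb -> is_Cseries (fun n => a n - b n) (la - lb).
Proof. apply (is_series_minus (K := C_AbsRing) (V := C_NormedModule)). Qed.

Lemma is_Cseries_unique (a : nat -> C) (l l' : C) :
  is_Cseries a l -> is_Cseries a l' -> l = l'.
Proof. intros H H'; now rewrite <- (CSeries_unique _ _ H), <- (CSeries_unique _ _ H'). Qed.

Local Notation Csum := (sum_n (G := C_AbelianMonoid)).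

Lemma Csum_Sn (a : nat -> C) (n : nat) : Csum a (S n) = Csum a n + a (S n).
Proof. exact (sum_Sn _ _). Qed.

Lemma Csum_O (a : nat -> C) : Csum a 0 = a 0%nat.
Proof. exact (sum_O _). Qed.

Lemma is_Cseries_Csum (a : nat -> nat -> C) (l : nat -> C) (M : nat) :
  (forall j, (j <= M)%nat -> is_Cseries (a j) (l j)) ->
  is_Cseries (fun n => Csum (fun j => a j n) M) (Csum l M).
Proof.
intros H; induction M as [|M IH].
- rewrite Csum_O; apply (is_Cseries_ext (a 0%nat)); [|apply H; lia].
  intros n; now rewrite Csum_O.
- rewrite Csum_Sn; apply (is_Cseries_ext (fun n => Csum (fun j => a j n) M + a (S M) n)).
  + intros n; now rewrite Csum_Sn.
  + apply is_Cseries_plus; [|apply H; lia].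
    apply IH; intros; apply H; lia.
Qed.

Lemma Csum_scal (c : C) (a : nat -> C) (n : nat) :
  Csum (fun j => c * a j) n = c * Csum a n.
Proof.
induction n as [|n IH]; [now rewrite !Csum_O|].
rewrite !Csum_Sn, IH; eq_in_C; ring.
Qed.

Lemma Csum_RtoC (a : nat -> R) (n : nat) :
  Csum (fun j => RtoC (a j)) n = RtoC (sum_n a n).
Proof.
induction n as [|n IH]; [now rewrite Csum_O, sum_O|].
rewrite Csum_Sn, sum_n_R_Sn, IH, RtoC_plus; easy.
Qed.

Lemma is_Cseries_RtoC (a : nat -> R) (l : R) :
  is_series a l -> is_Cseries (fun n => RtoC (a n)) (RtoC l).
Proof.
intros H; apply (is_Cseries_of_bound _ _ (fun N => Rabs (sum_n a N - l))).
- exists 0%nat; intros N _; rewrite Csum_RtoC, <- RtoC_minus, Cmod_R; apply Rle_refl.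
- apply (proj1 (is_lim_seq_abs_0 _)); replace (Finite 0) with (Finite (l - l)%R) by (f_equal; ring).
  apply is_lim_seq_minus'; [exact H|apply is_lim_seq_const].
Qed.

Lemma is_Cseries_zetaR (k : nat) : (2 <= k)%nat ->
  is_Cseries (fun n => / RtoC (INR (S n)) ^ k) (RtoC (zetaR k)).
Proof.
intros Hk; apply (is_Cseries_ext (fun n => RtoC (/ INR (S n) ^ k))).
- intros n; rewrite RtoC_inv, RtoC_pow; [easy|].
  apply pow_nonzero; generalize (INR_S_ge_1 n); lra.
- apply is_Cseries_RtoC, is_series_zetaR, Hk.
Qed.

Lemma npow_INR (n k : nat) : npow (S n) (RtoC (INR k)) = RtoC (INR (S n)) ^ k.
Proof.
unfold npow; rewrite <- RtoC_mult, Cexp_RtoC, <- RtoC_pow; f_equal.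
rewrite <- ln_pow by (generalize (INR_S_ge_1 n); lra).
apply exp_ln, pow_lt; generalize (INR_S_ge_1 n); lra.
Qed.

Lemma CSeries_ext (a b : nat -> C) : (forall n, a n = b n) -> CSeries a = CSeries b.
Proof.
intros H; unfold CSeries; f_equal; apply Series_ext; intros; now rewrite H.
Qed.

Lemma zeta_INR (k : nat) : (2 <= k)%nat -> zeta (RtoC (INR k)) = RtoC (zetaR k).
Proof.
intros Hk; rewrite <- (CSeries_unique _ _ (is_Cseries_zetaR k Hk)).
apply CSeries_ext; intros; now rewrite npow_INR.
Qed.

Lemma is_Cseries_CSeries (a : nat -> C) (b : nat -> R) :
  (forall n, Cmod (a n) <= b n)%R -> ex_series b -> is_Cseries a (CSeries a).
Proof.
intros H Hb.
destruct (ex_series_le (K := C_AbsRing) (V := C_CompleteNormedModule) a b) as [l Hl].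
- exact H.
- easy.
- now rewrite (CSeries_unique a l Hl).
Qed.

(** Serves [S_fun] with [e = -1] and [T_fun] with [e = 1]. The modulus of the exponential increases
    with [n], so its value at the first term bounds all of them. *)
Lemma Cmod_Cexp_plus_unit_ge (x e : C) (n : nat) : (0 < Re x)%R -> Cmod e = 1%R ->
  (exp (Re x) - 1 <= Cmod (Cexp (x * RtoC (INR (S n))) + e))%R.
Proof.
intros Hx He; set (z := Cexp _).
assert (H := Cmod_triangle (z + e) (- e)).
replace (z + e + - e) with z in H by ring; rewrite Cmod_opp, He in H.
assert (Hz : (exp (Re x) <= Cmod z)%R); [|lra].
unfold z; rewrite Cmod_Cexp, re_scal_r.
assert (Hle : (Re x <= Re x * INR (S n))%R) by (generalize (INR_S_ge_1 n); nra).
destruct Hle as [Hl|<-]; [left; now apply exp_increasing|apply Rle_refl].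
Qed.

Lemma is_Cseries_Cexp_plus_unit (k : nat) (x e : C) : (2 <= k)%nat ->
  (0 < Re x)%R -> Cmod e = 1%R ->
  let a n := / (RtoC (INR (S n)) ^ k * (Cexp (x * RtoC (INR (S n))) + e)) in
  is_Cseries a (CSeries a).
Proof.
intros Hk Hx He a.
assert (H1 : (0 < exp (Re x) - 1)%R)
  by (generalize (exp_increasing 0 (Re x) Hx); rewrite exp_0; lra).
apply (is_Cseries_CSeries _ (fun n => / (exp (Re x) - 1) * / INR (S n) ^ k)%R).
- intros n; unfold a; assert (H := Cmod_Cexp_plus_unit_ge x e n Hx He).
  set (z := Cexp _ + e) in *.
  assert (H2 : (0 < INR (S n) ^ k)%R) by (apply pow_lt; generalize (INR_S_ge_1 n); lra).
  assert (z <> 0) by (apply Cmod_gt_0; lra).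
  assert (RtoC (INR (S n)) ^ k <> 0) by (apply Cpow_nz, INR_C_neq_0; lia).
  rewrite Cmod_inv, Cmod_mult by now apply Cmult_neq_0.
  rewrite <- RtoC_pow, Cmod_R, Rabs_pos_eq, Rmult_comm, Rinv_mult by lra.
  apply Rmult_le_compat_r; [left; now apply Rinv_0_lt_compat|].
  now apply Rinv_le_contravar.
- eexists; apply (is_series_scal (K := R_AbsRing) (V := R_NormedModule)).
  now apply is_series_zetaR.
Qed.

Lemma is_Cseries_S_fun (k : nat) (x : C) : (2 <= k)%nat -> (0 < Re x)%R ->
  is_Cseries (fun n => / (RtoC (INR (S n)) ^ k * (Cexp (x * RtoC (INR (S n))) - 1)))
    (S_fun (RtoC (INR k)) x).
Proof.
intros Hk Hx.
replace (S_fun (RtoC (INR k)) x) with (CSeries (fun n =>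
  / (RtoC (INR (S n)) ^ k * (Cexp (x * RtoC (INR (S n))) - 1)))).
- apply (is_Cseries_Cexp_plus_unit k x (- (1)) Hk Hx Cmod_m1).
- apply CSeries_ext; intros n; now rewrite npow_INR.
Qed.

Lemma is_Cseries_T_fun (k : nat) (x : C) : (2 <= k)%nat -> (0 < Re x)%R ->
  is_Cseries (fun n => / (RtoC (INR (S n)) ^ k * (Cexp (x * RtoC (INR (S n))) + 1)))
    (T_fun (RtoC (INR k)) x).
Proof.
intros Hk Hx.
replace (T_fun (RtoC (INR k)) x) with (CSeries (fun n =>
  / (RtoC (INR (S n)) ^ k * (Cexp (x * RtoC (INR (S n))) + 1)))).
- apply (is_Cseries_Cexp_plus_unit k x 1 Hk Hx Cmod_1).
- apply CSeries_ext; intros n; now rewrite npow_INR.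
Qed.

Ltac solve_neq_0 := repeat split; try easy; try apply C2_neq_0; try (rewrite Cpow_mult_l; easy).

Definition partial_fractions (w : C) : C :=
  / w * (RtoC PI * (/ (Cexp (2 * RtoC PI * w) - 1) + / 2) - / (2 * w)).

Lemma Re_mult_INR_pos (t : C) (n : nat) : (0 < Re t)%R -> (0 < Re (t * RtoC (INR (S n))))%R.
Proof.
intros Ht; rewrite re_scal_r; generalize (INR_S_ge_1 n); nra.
Qed.

Lemma Re_2PI_pos (t : C) : (0 < Re t)%R -> (0 < Re (2 * RtoC PI * t))%R.
Proof.
intros Ht; rewrite <- RtoC_mult, re_scal_l; generalize PI_RGT_0; nra.
Qed.

Lemma Re_inv_pos (t : C) : (0 < Re t)%R -> (0 < Re (/ t))%R.
Proof.
intros Ht; destruct t as [x y]; simpl in *.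
apply Rdiv_lt_0_compat; nra.
Qed.

(** At [w = t n] the prefactor [1 / w] raises the power of [n] by one: the exponential term gives
    [S_fun], the summand 1/2 gives the first zeta value, and [-1/(2w)], with one more power of [n],
    the second. *)
Lemma is_Cseries_pow_partial_fractions (k : nat) (t : C) : (0 < Re t)%R -> (1 <= k)%nat ->
  is_Cseries (fun n => / RtoC (INR (S n)) ^ k * partial_fractions (t * RtoC (INR (S n))))
    (RtoC PI / t * (S_fun (RtoC (INR (S k))) (2 * RtoC PI * t) + / 2 * RtoC (zetaR (S k)))
     - / (2 * t ^ 2) * RtoC (zetaR (S (S k)))).
Proof.
intros Ht Hk; assert (Ht0 := Re_pos_neq_0 _ Ht).
apply (is_Cseries_ext (fun n => RtoC PI / t *
  (/ (RtoC (INR (S n)) ^ S k * (Cexp (2 * RtoC PI * t * RtoC (INR (S n))) - 1))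
   + / 2 * / RtoC (INR (S n)) ^ S k) - / (2 * t ^ 2) * / RtoC (INR (S n)) ^ S (S k))).
- intros n; unfold partial_fractions.
  assert (Hx := Cexp_neq_1 _ (Re_mult_INR_pos _ n (Re_2PI_pos _ Ht))).
  replace (2 * RtoC PI * (t * RtoC (INR (S n)))) with (2 * RtoC PI * t * RtoC (INR (S n))) by ring.
  apply Cminus_eq_contra in Hx.
  set (E := Cexp _) in *.
  assert (HN := INR_C_neq_0 (S n) ltac:(lia)).
  set (N := RtoC (INR (S n))) in *.
  assert (HNk := Cpow_nz N k HN).
  rewrite !Cpow_S; set (Nk := N ^ k) in *.
  field; repeat split; try easy; apply C2_neq_0.
- apply is_Cseries_minus; apply is_Cseries_scal.
  + apply is_Cseries_plus.
    * apply is_Cseries_S_fun; [lia|now apply Re_2PI_pos].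
    * apply is_Cseries_scal, is_Cseries_zetaR; lia.
  + apply is_Cseries_zetaR; lia.
Qed.

(* Geometric sum of ratio [- t^2 N^2 / L^2]; an even power of the ratio loses its sign. *)
Lemma inv_quadratic_geom (t N L : C) (M : nat) : L <> 0 -> t ^ 2 * N ^ 2 + L ^ 2 <> 0 ->
  Csum (fun j => (- (1)) ^ j * t ^ (2 * j) * N ^ (2 * j) / L ^ (2 * j + 2)) M =
  (1 - (- (1)) ^ S M * t ^ (2 * S M) * N ^ (2 * S M) / L ^ (2 * S M)) / (t ^ 2 * N ^ 2 + L ^ 2).
Proof.
intros HL Hq; induction M as [|M IH].
- rewrite Csum_O; change (2 * 1)%nat with 2%nat; change (2 * 0)%nat with 0%nat; change (0 + 2)%nat with 2%nat.
  rewrite Cpow_1_r; change (t ^ 0) with (RtoC 1); change (N ^ 0) with (RtoC 1); change ((- (1)) ^ 0) with (RtoC 1).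
  eq_in_C; field; solve_neq_0.
- rewrite Csum_Sn, IH; eq_in_C.
  replace (2 * S (S M))%nat with (2 * S M + 2)%nat by lia.
  rewrite !Cpow_add_r, (Cpow_S _ (S M)).
  assert (HLM := Cpow_nz L (2 * S M) HL).
  set (LM := L ^ (2 * S M)) in *; set (NM := N ^ (2 * S M)); set (tM := t ^ (2 * S M)).
  set (s := (- (1)) ^ S M).
  field; solve_neq_0.
Qed.

(** Both factors [t N + i L] and [t N - i L] have real part [Re t * N]. The bound is uniform in [L],
    which allows domination by a product. *)
Lemma Cmod_quadratic_ge (t : C) (N L : R) : (0 < Re t)%R -> (0 <= N)%R ->
  (Re t ^ 2 * N ^ 2 <= Cmod (t ^ 2 * RtoC N ^ 2 + RtoC L ^ 2))%R.
Proof.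
intros Ht HN.
rewrite <- Cpow_mult_l, Csquare_plus_factor, Cmod_mult.
replace (Re t ^ 2 * N ^ 2)%R with ((Re t * N) * (Re t * N))%R by ring.
assert (0 <= Re t * N)%R by nra.
apply Rmult_le_compat; try easy.
- eapply Rle_trans; [|apply re_le_Cmod]; eapply Rle_trans; [|apply Rle_abs].
  destruct t; simpl; right; ring.
- eapply Rle_trans; [|apply re_le_Cmod]; eapply Rle_trans; [|apply Rle_abs].
  destruct t; simpl; right; ring.
Qed.

Lemma S_fun_zeta_products (t : C) (q : nat) (M := (2 * q + 1)%nat) (k := (2 * M + 3)%nat) :
  (0 < Re t)%R ->
  RtoC PI / t * (S_fun (RtoC (INR k)) (2 * RtoC PI * t) + / 2 * RtoC (zetaR k))
     - / (2 * t ^ 2) * RtoC (zetaR (S k))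
  - Csum (fun j => (- (1)) ^ j * t ^ (2 * j) * RtoC (zetaR (2 * (M - j) + 2)) * RtoC (zetaR (2 * j + 2))) M
  = t ^ (2 * M) *
    (RtoC PI * t * (S_fun (RtoC (INR k)) (2 * RtoC PI * / t) + / 2 * RtoC (zetaR k))
     - t ^ 2 / 2 * RtoC (zetaR (S k))).
Proof.
intros Ht; assert (Ht0 := Re_pos_neq_0 _ Ht).
assert (Hneg : (- (1)) ^ S M = 1).
{ replace (S M) with (2 * (q + 1))%nat by (unfold M; lia).
  rewrite Cpow_mult_r; replace ((- (1)) ^ 2) with (RtoC 1) by ring; apply Cpow_1_l. }
assert (Hq : forall n l, t ^ 2 * RtoC (INR (S n)) ^ 2 + RtoC (INR (S l)) ^ 2 <> 0).
{ intros n l; rewrite <- Cpow_mult_l; now apply Csquare_plus_neq_0, Re_mult_INR_pos. }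
assert (HN : forall n, RtoC (INR (S n)) <> 0) by (intros; apply INR_C_neq_0; lia).
(* The term exchanged is the [l]-form: its factor [l^(-2M-2)] together with
   [|t^2 n^2 + l^2| >= (Re t)^2 n^2] gives the dominating product [u n * v l]. The left-hand side of
   the lemma is the sum of the row sums, the right-hand side that of the column sums. *)
set (a := fun n l => t ^ (2 * M + 2) * / RtoC (INR (S l)) ^ (2 * M + 2)
   * / (t ^ 2 * RtoC (INR (S n)) ^ 2 + RtoC (INR (S l)) ^ 2)).
set (rowj := fun n j => / RtoC (INR (S n)) ^ (2 * (M - j) + 2)).
apply (is_Cseries_unique (fun l => t ^ (2 * M) *
   (/ RtoC (INR (S l)) ^ (2 * M + 2) * partial_fractions (/ t * RtoC (INR (S l)))))).
- set (u := fun n : nat => (Cmod (t ^ (2 * M + 2)) * / Re t ^ 2 * / INR (S n) ^ 2)%R).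
  set (v := fun l : nat => (/ INR (S l) ^ (2 * M + 2))%R).
  refine (is_series_swap (K := C_AbsRing) (V := C_NormedModule) a u v
   (fun n => / RtoC (INR (S n)) ^ (2 * M + 2) * partial_fractions (t * RtoC (INR (S n)))
     - Csum (fun j => ((- (1)) ^ j * t ^ (2 * j) * RtoC (zetaR (2 * j + 2))) * rowj n j) M)
    _ _ _ _ _ _ _ _ _ _).
  + intros n l; change (Cmod (a n l) <= u n * v l)%R; unfold a, u, v.
    assert (Hge := Cmod_quadratic_ge t (INR (S n)) (INR (S l)) Ht (pos_INR _)).
    assert (0 < INR (S n))%R by (generalize (INR_S_ge_1 n); lra).
    assert (0 < INR (S l))%R by (generalize (INR_S_ge_1 l); lra).
    assert (0 < INR (S l) ^ (2 * M + 2))%R by now apply pow_lt.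
    assert (0 < Re t ^ 2)%R by now apply pow_lt.
    assert (0 < INR (S n) ^ 2)%R by now apply pow_lt.
    rewrite !Cmod_mult, !Cmod_inv, <- RtoC_pow, Cmod_R, (Rabs_pos_eq (_ ^ _)%R)
      by (lra || apply Hq || apply Cpow_nz, HN).
    rewrite !Rmult_assoc; apply Rmult_le_compat_l; [apply Cmod_ge_0|].
    rewrite (Rmult_comm (/ INR (S l) ^ _)), <- Rmult_assoc.
    apply Rmult_le_compat_r; [left; now apply Rinv_0_lt_compat|].
    rewrite <- Rinv_mult; apply Rinv_le_contravar; [now apply Rmult_lt_0_compat|exact Hge].
  + intros n; unfold u; repeat apply Rmult_le_pos; [apply Cmod_ge_0| |];
     left; apply Rinv_0_lt_compat, pow_lt; [easy|generalize (INR_S_ge_1 n); lra].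
  + intros l; left; apply Rinv_0_lt_compat, pow_lt; generalize (INR_S_ge_1 l); lra.
  + eexists; apply (is_series_scal (K := R_AbsRing) (V := R_NormedModule)).
    apply is_series_zetaR; lia.
  + apply ex_series_inv_pow; lia.
  (* Rows: by [inv_quadratic_geom], where [(-1)^(M+1) = 1], the term is
     [n^(-2M-2) / (t^2 n^2 + l^2)] minus a polynomial in [l^(-2)], which sums over [l] to zeta
     values. *)
  + intros n.
    apply (is_Cseries_ext (fun l =>
      / RtoC (INR (S n)) ^ (2 * M + 2) * / ((t * RtoC (INR (S n))) ^ 2 + RtoC (INR (S l)) ^ 2)
      - Csum (fun j => ((- (1)) ^ j * t ^ (2 * j) * rowj n j) * / RtoC (INR (S l)) ^ (2 * j + 2)) M)).
    * intros l; unfold a.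
      assert (HNn := HN n); assert (HNl := HN l); assert (Hqn := Hq n l).
      rewrite Cpow_mult_l.
      set (N := RtoC (INR (S n))) in *; set (L := RtoC (INR (S l))) in *.
      transitivity (/ N ^ (2 * M + 2) * (/ (t ^ 2 * N ^ 2 + L ^ 2) -
        Csum (fun j => (- (1)) ^ j * t ^ (2 * j) * N ^ (2 * j) / L ^ (2 * j + 2)) M)).
      -- transitivity (/ N ^ (2 * M + 2) * / (t ^ 2 * N ^ 2 + L ^ 2) - / N ^ (2 * M + 2) *
          Csum (fun j => (- (1)) ^ j * t ^ (2 * j) * N ^ (2 * j) / L ^ (2 * j + 2)) M); [|ring].
         rewrite <- Csum_scal.
         f_equal; apply (sum_n_ext_loc (G := C_AbelianMonoid)); intros j Hj; eq_in_C.
         unfold rowj; fold N.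
         replace (2 * M + 2)%nat with (2 * (M - j) + 2 + 2 * j)%nat by lia.
         rewrite (Cpow_add_r N (2 * (M - j) + 2)).
         assert (H1 := Cpow_nz N (2 * (M - j) + 2) HNn); assert (H2 := Cpow_nz N (2 * j) HNn).
         assert (H3 := Cpow_nz L (2 * j + 2) HNl).
         set (x1 := N ^ (2 * (M - j) + 2)) in *; set (x2 := N ^ (2 * j)) in *;
         set (x3 := L ^ (2 * j + 2)) in *.
         field; solve_neq_0.
      -- rewrite inv_quadratic_geom, Hneg by easy.
         replace (2 * S M)%nat with (2 * M + 2)%nat by lia.
         assert (H1 := Cpow_nz N (2 * M + 2) HNn); assert (H2 := Cpow_nz L (2 * M + 2) HNl).
         set (x1 := N ^ (2 * M + 2)) in *; set (x2 := L ^ (2 * M + 2)) in *.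
         set (x3 := t ^ (2 * M + 2)).
         field; solve_neq_0.
    * apply is_Cseries_minus.
      -- apply is_Cseries_scal; apply is_Cseries_partial_fractions, Re_mult_INR_pos, Ht.
      -- replace (Csum (fun j => (- (1)) ^ j * t ^ (2 * j) * RtoC (zetaR (2 * j + 2)) * rowj n j) M)
          with (Csum (fun j => ((- (1)) ^ j * t ^ (2 * j) * rowj n j) * RtoC (zetaR (2 * j + 2))) M)
          by (apply (sum_n_ext (G := C_AbelianMonoid)); intros j; eq_in_C; ring).
         apply is_Cseries_Csum with (a := fun j l =>
           ((- (1)) ^ j * t ^ (2 * j) * rowj n j) * / RtoC (INR (S l)) ^ (2 * j + 2)).
         intros j Hj; apply is_Cseries_scal, is_Cseries_zetaR; lia.
  (* Columns: [t^2 / (t^2 n^2 + l^2) = 1 / ((l/t)^2 + n^2)], the partial fractions at [w = l/t]. *)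
  + intros l.
    assert (HNl := HN l).
    apply (is_Cseries_ext (fun n => t ^ (2 * M) * (/ RtoC (INR (S l)) ^ (2 * M + 2) *
        / ((/ t * RtoC (INR (S l))) ^ 2 + RtoC (INR (S n)) ^ 2)))).
    * intros n; unfold a; assert (Hqn := Hq n l).
      rewrite Cpow_mult_l, Cpow_inv by easy.
      rewrite (Cpow_add_r t).
      assert (H2 := Cpow_nz _ (2 * M + 2) HNl).
      set (N := RtoC (INR (S n))) in *; set (L := RtoC (INR (S l))) in *.
      set (x2 := L ^ (2 * M + 2)) in *; set (x3 := t ^ (2 * M)).
      field; solve_neq_0.
    * do 2 apply is_Cseries_scal; apply is_Cseries_partial_fractions, Re_mult_INR_pos.
      now apply Re_inv_pos.
  + apply is_Cseries_minus.
    * replace k with (S (2 * M + 2)) by (unfold k; lia).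
      apply is_Cseries_pow_partial_fractions; [easy|lia].
    * replace (Csum (fun j => (- (1)) ^ j * t ^ (2 * j) * RtoC (zetaR (2 * (M - j) + 2)) * RtoC (zetaR (2 * j + 2))) M)
       with (Csum (fun j => ((- (1)) ^ j * t ^ (2 * j) * RtoC (zetaR (2 * j + 2))) * RtoC (zetaR (2 * (M - j) + 2))) M)
        by (apply (sum_n_ext (G := C_AbelianMonoid)); intros j; eq_in_C; ring).
      apply is_Cseries_Csum with (a := fun j n => (- (1)) ^ j * t ^ (2 * j) * RtoC (zetaR (2 * j + 2)) * rowj n j).
      intros j Hj; apply is_Cseries_scal, is_Cseries_zetaR; lia.
- apply is_Cseries_scal.
  assert (H := is_Cseries_pow_partial_fractions (2 * M + 2) (/ t) (Re_inv_pos _ Ht) ltac:(lia)).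
  replace (S (2 * M + 2)) with k in H by (unfold k; lia).
  replace (RtoC PI * t) with (RtoC PI / / t) by (field; easy).
  replace (t ^ 2 / 2) with (/ (2 * (/ t) ^ 2)) by (field; easy).
  exact H.
Qed.

(** * Identification of the zeta products with [I_fun] *)

Lemma Csum_first (f : nat -> C) (M : nat) :
  Csum f (S M) = f 0%nat + Csum (fun j => f (S j)) M.
Proof.
induction M as [|M IH]; [now rewrite Csum_Sn, !Csum_O|].
rewrite Csum_Sn, IH, Csum_Sn; eq_in_C; ring.
Qed.

Lemma bernoulli_product (M p : nat) : (p <= M)%nat ->
  (Binomial.C (2 * M + 4) (2 * p + 2) * (2 * PI) ^ (2 * M + 4)
    * bernoulli (2 * p + 2) * bernoulli (2 * (M - p) + 2) =
   4 * (-1) ^ M * zetaR (2 * (M - p) + 2) * zetaR (2 * p + 2) * INR (fact (2 * M + 4)))%R.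
Proof.
intros Hp.
assert (H1 := zetaR_even p); assert (H2 := zetaR_even (M - p)).
replace ((2 * PI) ^ (2 * M + 4))%R with ((2 * PI) ^ (2 * p + 2) * (2 * PI) ^ (2 * (M - p) + 2))%R
  by (rewrite <- pow_add; f_equal; lia).
replace ((-1) ^ M)%R with ((-1) ^ p * (-1) ^ (M - p))%R
  by (rewrite <- pow_add; f_equal; lia).
unfold Binomial.C; replace (2 * M + 4 - (2 * p + 2))%nat with (2 * (M - p) + 2)%nat by lia.
assert (F1 := INR_fact_neq_0 (2 * p + 2)); assert (F2 := INR_fact_neq_0 (2 * (M - p) + 2)).
set (f1 := INR (fact (2 * p + 2))) in *; set (f2 := INR (fact (2 * (M - p) + 2))) in *.
transitivity (INR (fact (2 * M + 4)) / (f1 * f2) *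
  ((2 * PI) ^ (2 * p + 2) * bernoulli (2 * p + 2)) *
  ((2 * PI) ^ (2 * (M - p) + 2) * bernoulli (2 * (M - p) + 2)))%R; [ring|].
rewrite <- H1, <- H2; field; easy.
Qed.

Lemma Ci_pow_even (r : nat) : Ci ^ (2 * r) = (- (1)) ^ r.
Proof.
rewrite Cpow_mult_r; f_equal; apply injective_projections; simpl; ring.
Qed.

Lemma Cneg1_pow_even (r : nat) : (- (1)) ^ (2 * r) = 1.
Proof.
rewrite Cpow_mult_r; replace ((- (1)) ^ 2) with (RtoC 1) by ring; apply Cpow_1_l.
Qed.

Lemma Cneg1_pow_RtoC (r : nat) : (- (1)) ^ r = RtoC ((-1) ^ r).
Proof. now rewrite RtoC_pow, <- RtoC_opp. Qed.

Lemma Cneg1_pow_even_sub (r p : nat) : (p <= 2 * r)%nat -> (- (1)) ^ (2 * r - p) = (- (1)) ^ p.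
Proof.
intros Hp.
assert (Hs : forall n, (- (1)) ^ n * (- (1)) ^ n = 1).
{ intros n; rewrite <- Cpow_add_r; replace (n + n)%nat with (2 * n)%nat by lia.
  apply Cneg1_pow_even. }
transitivity ((- (1)) ^ (2 * r - p) * ((- (1)) ^ p * (- (1)) ^ p)); [rewrite Hs; ring|].
rewrite Cmult_assoc, <- Cpow_add_r.
replace (2 * r - p + p)%nat with (2 * r)%nat by lia.
rewrite Cneg1_pow_even; ring.
Qed.

Lemma RtoC_2PI_pow (n : nat) : (2 * RtoC PI) ^ n = RtoC ((2 * PI) ^ n).
Proof. now rewrite RtoC_pow, RtoC_mult. Qed.

Definition I_term (k : nat) (x : C) (j : nat) : C :=
  RtoC (Binomial.C (k + 1) (2 * j)) * x ^ (2 * j)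
  * (2 * RtoC PI * Ci) ^ (k + 1 - 2 * j)
  * RtoC (bernoulli (2 * j)) * RtoC (bernoulli (k + 1 - 2 * j)).

Lemma I_term_succ (t : C) (q p : nat) (M := (2 * q + 1)%nat) : (p <= M)%nat ->
  I_term (2 * M + 3) (2 * RtoC PI * t) (S p) =
  - (4) * RtoC (INR (fact (2 * M + 4))) * t ^ 2 * ((- (1)) ^ p * t ^ (2 * p)
    * RtoC (zetaR (2 * (M - p) + 2)) * RtoC (zetaR (2 * p + 2))).
Proof.
intros Hp; unfold I_term.
replace (2 * M + 3 + 1)%nat with (2 * M + 4)%nat by lia.
replace (2 * S p)%nat with (2 * p + 2)%nat by lia.
replace (2 * M + 4 - (2 * p + 2))%nat with (2 * (M - p) + 2)%nat by lia.
assert (H := f_equal RtoC (bernoulli_product M p Hp)).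
rewrite !RtoC_mult in H.
rewrite (Cpow_mult_l _ Ci), (Cpow_mult_l _ t).
(* As [M + 1 = 2 (q + 1)] is even, [i^(2 (M - p) + 2) = (-1)^p]. The minus sign in [- (4)] is the
   factor [(-1)^M] of [bernoulli_product]. *)
replace (2 * (M - p) + 2)%nat with (2 * (2 * (q + 1) - p))%nat at 2 by (unfold M in *; lia).
rewrite Ci_pow_even, Cneg1_pow_even_sub by (unfold M in *; lia).
rewrite !RtoC_2PI_pow.
transitivity ((- (1)) ^ p * t ^ (2 * p + 2) * (RtoC (Binomial.C (2 * M + 4) (2 * p + 2)) *
  RtoC ((2 * PI) ^ (2 * M + 4)) * RtoC (bernoulli (2 * p + 2)) * RtoC (bernoulli (2 * (M - p) + 2)))).
- replace ((2 * PI) ^ (2 * M + 4))%R with ((2 * PI) ^ (2 * p + 2) * (2 * PI) ^ (2 * (M - p) + 2))%R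
    by (rewrite <- pow_add; f_equal; lia).
  rewrite RtoC_mult; ring.
- rewrite H, <- Cneg1_pow_RtoC.
  replace ((- (1)) ^ M) with (RtoC (-1)).
  + rewrite (Cpow_add_r t); ring.
  + unfold M; rewrite Cpow_add_r, Cneg1_pow_even; ring.
Qed.

Lemma I_term_first (t : C) (q : nat) (M := (2 * q + 1)%nat) :
  I_term (2 * M + 3) (2 * RtoC PI * t) 0 =
  - (2) * RtoC (INR (fact (2 * M + 4))) * RtoC (zetaR (2 * M + 4)).
Proof.
unfold I_term.
replace (2 * M + 3 + 1)%nat with (2 * M + 4)%nat by lia.
replace (2 * M + 4 - 2 * 0)%nat with (2 * M + 4)%nat by lia.
change (2 * 0)%nat with 0%nat; change ((2 * RtoC PI * t) ^ 0) with (RtoC 1).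
rewrite bernoulli_0, (Cpow_mult_l _ Ci).
replace (Ci ^ (2 * M + 4)) with (- (1)).
2: { replace (2 * M + 4)%nat with (2 * (2 * (q + 1) + 1))%nat by (unfold M; lia).
  rewrite Ci_pow_even, Cpow_add_r, Cneg1_pow_even; ring. }
replace (Binomial.C (2 * M + 4) 0) with 1%R
  by (unfold Binomial.C; rewrite Nat.sub_0_r; simpl (fact 0); simpl (INR 1); field; apply INR_fact_neq_0).
assert (H := f_equal RtoC (zetaR_even (M + 1))).
replace (2 * (M + 1) + 2)%nat with (2 * M + 4)%nat in H by lia.
rewrite !RtoC_mult, <- Cneg1_pow_RtoC in H.
replace ((- (1)) ^ (M + 1)) with (RtoC 1) in H
  by (replace (M + 1)%nat with (2 * (q + 1))%nat by (unfold M; lia); now rewrite Cneg1_pow_even).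
rewrite RtoC_2PI_pow.
transitivity (- (RtoC ((2 * PI) ^ (2 * M + 4)) * RtoC (bernoulli (2 * M + 4)))); [ring|].
rewrite <- H; ring.
Qed.

Lemma I_term_last (t : C) (q : nat) (M := (2 * q + 1)%nat) :
  I_term (2 * M + 3) (2 * RtoC PI * t) (S (S M)) =
  2 * t ^ (2 * M + 4) * RtoC (INR (fact (2 * M + 4))) * RtoC (zetaR (2 * M + 4)).
Proof.
unfold I_term.
replace (2 * M + 3 + 1)%nat with (2 * M + 4)%nat by lia.
replace (2 * S (S M))%nat with (2 * M + 4)%nat by lia.
rewrite Nat.sub_diag, bernoulli_0, (Cpow_mult_l _ t).
change ((2 * RtoC PI * Ci) ^ 0) with (RtoC 1).
replace (Binomial.C (2 * M + 4) (2 * M + 4)) with 1%R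
  by (unfold Binomial.C; rewrite Nat.sub_diag; simpl (fact 0); simpl (INR 1); field; apply INR_fact_neq_0).
assert (H := f_equal RtoC (zetaR_even (M + 1))).
replace (2 * (M + 1) + 2)%nat with (2 * M + 4)%nat in H by lia.
rewrite !RtoC_mult, <- Cneg1_pow_RtoC in H.
replace ((- (1)) ^ (M + 1)) with (RtoC 1) in H
  by (replace (M + 1)%nat with (2 * (q + 1))%nat by (unfold M; lia); now rewrite Cneg1_pow_even).
rewrite RtoC_2PI_pow.
transitivity (t ^ (2 * M + 4) * (RtoC ((2 * PI) ^ (2 * M + 4)) * RtoC (bernoulli (2 * M + 4)))); [ring|].
rewrite <- H; ring.
Qed.

Lemma S_fun_modular (m : nat) (t : C) : (1 <= m)%nat -> (0 < Re t)%R ->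
  S_fun (RtoC (INR (4 * m + 1))) (2 * RtoC PI * t) =
  I_fun (4 * m + 1) (2 * RtoC PI * t)
  + t ^ (4 * m) * S_fun (RtoC (INR (4 * m + 1))) (2 * RtoC PI * / t).
Proof.
intros Hm Ht; assert (Ht0 := Re_pos_neq_0 _ Ht).
assert (HPI : RtoC PI <> 0) by (intros E; apply RtoC_inj in E; generalize PI_RGT_0; lra).
set (q := (m - 1)%nat); set (M := (2 * q + 1)%nat).
assert (H := S_fun_zeta_products t q Ht); cbv zeta in H; fold M in H.
replace (4 * m)%nat with (2 * M + 2)%nat by (unfold M, q; lia).
replace (2 * M + 2 + 1)%nat with (2 * M + 3)%nat by lia.
unfold I_fun.
replace (2 * M + 3 - 1)%nat with (2 * M + 2)%nat by lia.
replace ((2 * M + 3 + 1) / 2)%nat with (S (S M))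
  by (replace (2 * M + 3 + 1)%nat with (S (S M) * 2)%nat by lia; now rewrite Nat.div_mul by lia).
change (sum_n _ (S (S M))) with (Csum (I_term (2 * M + 3) (2 * RtoC PI * t)) (S (S M))).
assert (HL := I_term_last t q); assert (HF := I_term_first t q).
cbv zeta in HL, HF; fold M in HL, HF.
rewrite Csum_Sn, Csum_first, HL, HF.
replace (Csum (fun j => I_term (2 * M + 3) (2 * RtoC PI * t) (S j)) M) with
  (- (4) * RtoC (INR (fact (2 * M + 4))) * t ^ 2 * Csum (fun j => (- (1)) ^ j * t ^ (2 * j)
    * RtoC (zetaR (2 * (M - j) + 2)) * RtoC (zetaR (2 * j + 2))) M).
2: { rewrite <- Csum_scal; apply (sum_n_ext_loc (G := C_AbelianMonoid)); intros p Hp.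
  symmetry; now apply (I_term_succ t q). }
rewrite zeta_INR by lia.
(* The exponent [2 M + 2 = 4 m] is divisible by 4, so the power of [i] is 1. *)
replace ((2 * RtoC PI * t / (2 * RtoC PI * Ci)) ^ (2 * M + 2)) with (t ^ (2 * M + 2)).
2: { replace (2 * RtoC PI * t / (2 * RtoC PI * Ci)) with (t * / Ci)
    by (field; repeat split; [apply Ci_nz|easy]).
  rewrite Cpow_mult_l, Cpow_inv by apply Ci_nz.
  replace (2 * M + 2)%nat with (2 * (2 * (q + 1)))%nat by (unfold M; lia).
  rewrite Ci_pow_even, Cneg1_pow_even; field. }
replace (2 * M + 3 + 1)%nat with (2 * M + 4)%nat by lia.
replace (S (2 * M + 3)) with (2 * M + 4)%nat in H by lia.
replace (2 * M + 4)%nat with (2 * M + 2 + 2)%nat by lia.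
replace (2 * M + 4)%nat with (2 * M + 2 + 2)%nat in H by lia.
rewrite (Cpow_add_r t (2 * M + 2) 2).
rewrite (Cpow_add_r t (2 * M) 2).
assert (Hf : RtoC (INR (fact (2 * M + 2 + 2))) <> 0)
  by (intros E; apply RtoC_inj in E; now apply INR_fact_neq_0 in E).
set (f := RtoC (INR (fact _))) in *.
set (S1 := S_fun _ (2 * RtoC PI * t)) in *.
set (S2 := S_fun _ _) in *.
set (Z := Csum _ M) in *.
set (z := RtoC (zetaR (2 * M + 3))) in *.
set (z' := RtoC (zetaR (2 * M + 2 + 2))) in *.
set (s := t ^ (2 * M)) in *.
(* Brings in the left-hand side of [H] so that it can be rewritten; what remains is an identity of
   rational functions. *)
replace S1 with (t / RtoC PI * ((RtoC PI / t * (S1 + / 2 * z) - / (2 * t ^ 2) * z' - Z)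
   + / (2 * t ^ 2) * z' + Z) - / 2 * z) by (field; solve_neq_0).
rewrite H; field; solve_neq_0.
Qed.

(** * The special values *)

Lemma Cexp_PI_Ci_INR (n : nat) : Cexp (RtoC PI * Ci * RtoC (INR n)) = (- (1)) ^ n.
Proof.
induction n as [|n IH].
- simpl INR; rewrite Cmult_0_r; apply Cexp_0.
- rewrite S_INR, RtoC_plus, Cmult_plus_distr_l, Cexp_plus, IH, Cpow_S, Cmult_1_r, Cexp_PI_Ci; ring.
Qed.

Lemma T_fun_S_fun (k : nat) (x : C) : (2 <= k)%nat -> (0 < Re x)%R ->
  T_fun (RtoC (INR k)) x = S_fun (RtoC (INR k)) x - 2 * S_fun (RtoC (INR k)) (2 * x).
Proof.
intros Hk Hx.
assert (Hx2 : (0 < Re (2 * x))%R) by (rewrite re_scal_l; lra).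
apply (is_Cseries_unique _ _ _ (is_Cseries_T_fun k x Hk Hx)).
eapply is_Cseries_ext; [|apply is_Cseries_minus; [apply (is_Cseries_S_fun k x Hk Hx)|
  apply is_Cseries_scal, (is_Cseries_S_fun k _ Hk Hx2)]].
intros n; cbv beta.
assert (H1 := Cexp_neq_1 _ (Re_mult_INR_pos _ n Hx)).
assert (H2 := Cexp_neq_1 _ (Re_mult_INR_pos _ n Hx2)); revert H2.
replace (2 * x * RtoC (INR (S n))) with (x * RtoC (INR (S n)) + x * RtoC (INR (S n))) by ring.
rewrite Cexp_plus; set (e := Cexp _) in *; intros H2.
apply Cminus_eq_contra in H1; apply Cminus_eq_contra in H2.
replace (e * e - 1) with ((e - 1) * (e + 1)) in * by ring.
assert (H3 : e + 1 <> 0) by (intros E; apply H2; rewrite E; ring).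
assert (HN := Cpow_nz _ k (INR_C_neq_0 (S n) ltac:(lia))).
set (N := RtoC (INR (S n)) ^ k) in *.
field; repeat split; easy.
Qed.

(* A series over [n >= 1] is indexed from 0, so its terms with even [n] have odd index. *)
Definition at_odd (a : nat -> C) (n : nat) : C :=
  if Nat.odd n then a (Nat.div2 n) else 0.

(** The inserted zeros only repeat partial sums: those at [2 p + 1] and [2 p + 2] both equal the one
    of [a] at [p]. *)
Lemma is_Cseries_at_odd (a : nat -> C) (l : C) :
  is_Cseries a l -> is_Cseries (at_odd a) l.
Proof.
intros H.
assert (Heven : forall p, Csum (at_odd a) (2 * S p) = Csum (at_odd a) (S (2 * p))).
{ intros p; replace (2 * S p)%nat with (S (S (2 * p))) by lia.
  rewrite Csum_Sn; replace (at_odd a (S (S (2 * p)))) with (RtoC 0); [apply Cplus_0_r|].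
  unfold at_odd; replace (S (S (2 * p))) with (2 * S p)%nat by lia.
  now rewrite Nat.odd_mul. }
assert (Hodd : forall p, Csum (at_odd a) (S (2 * p)) = Csum a p).
{ intros p; induction p as [|p IH].
  - rewrite Csum_Sn; change (2 * 0)%nat with 0%nat; rewrite !Csum_O.
    unfold at_odd; simpl; ring.
  - rewrite Csum_Sn, Heven, IH, Csum_Sn; f_equal; unfold at_odd.
    rewrite Nat.odd_succ, Nat.even_mul; simpl (Nat.even 2); simpl orb; cbv iota.
    now rewrite Nat.div2_succ_double. }
apply filterlim_locally; intros eps.
destruct (proj1 (filterlim_locally _ _) H eps) as [N0 HN0].
exists (2 * N0 + 2)%nat; intros n Hn.
destruct (Nat.Even_or_Odd n) as [[p ->]|[p ->]].
- destruct p as [|p]; [lia|].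
  rewrite Heven, Hodd; apply HN0; lia.
- rewrite Nat.add_1_r, Hodd; apply HN0; lia.
Qed.

(** Since [e^((x - i PI) n) = (-1)^n e^(x n)], the terms with odd [n] are those of [- T_fun] at [x].
    Subtracting all of [T_fun] leaves [1/(e^(x n) - 1) + 1/(e^(x n) + 1)] to be restored for even
    [n = 2 p], where [n^k = 2^k p^k] and the argument is [2 x p]. *)
Lemma S_fun_shift (k : nat) (x : C) : (2 <= k)%nat -> (0 < Re x)%R ->
  S_fun (RtoC (INR k)) (x - RtoC PI * Ci) =
  / 2 ^ k * (T_fun (RtoC (INR k)) (2 * x) + S_fun (RtoC (INR k)) (2 * x))
  - T_fun (RtoC (INR k)) x.
Proof.
intros Hk Hx.
assert (Hx2 : (0 < Re (2 * x))%R) by (rewrite re_scal_l; lra).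
assert (Hx' : (0 < Re (x - RtoC PI * Ci))%R) by (destruct x; simpl in *; lra).
apply (is_Cseries_unique _ _ _ (is_Cseries_S_fun k _ Hk Hx')).
eapply is_Cseries_ext; [|apply is_Cseries_minus; [apply is_Cseries_at_odd, is_Cseries_scal,
  is_Cseries_plus; [apply (is_Cseries_T_fun k _ Hk Hx2)|apply (is_Cseries_S_fun k _ Hk Hx2)]
  |apply (is_Cseries_T_fun k x Hk Hx)]].
intros n; cbv beta.
assert (HN := Cpow_nz _ k (INR_C_neq_0 (S n) ltac:(lia))).
assert (H1 := Cexp_neq_1 _ (Re_mult_INR_pos _ n Hx)).
assert (H2 := Cexp_neq_1 _ (Re_mult_INR_pos _ n Hx2)); revert H2.
replace (2 * x * RtoC (INR (S n))) with (x * RtoC (INR (S n)) + x * RtoC (INR (S n))) by ring.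
replace ((x - RtoC PI * Ci) * RtoC (INR (S n)))
  with (x * RtoC (INR (S n)) + - (RtoC PI * Ci * RtoC (INR (S n)))) by ring.
rewrite !Cexp_plus, Cexp_opp, Cexp_PI_Ci_INR.
unfold at_odd; destruct (Nat.Even_or_Odd n) as [[p Hp]|[p Hp]].
- replace (Nat.odd n) with false
    by (rewrite Hp, Nat.odd_mul; easy).
  replace ((- (1)) ^ S n) with (- (1)) by (rewrite Hp, Cpow_S, Cneg1_pow_even; ring).
  set (e := Cexp _) in *; set (N := RtoC (INR (S n)) ^ k) in *.
  intros H2; apply Cminus_eq_contra in H1; apply Cminus_eq_contra in H2.
  replace (e * e - 1) with ((e - 1) * (e + 1)) in * by ring.
  assert (H3 : e + 1 <> 0) by (intros E; apply H2; rewrite E; ring).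
  replace (e * / - (1) - 1) with (- (e + 1)) by (field; intros E; apply RtoC_inj in E; lra).
  field; easy.
- replace (Nat.odd n) with true
    by (rewrite Hp, Nat.add_1_r, Nat.odd_succ, Nat.even_mul; easy).
  replace (Nat.div2 n) with p by (rewrite Hp, Nat.add_1_r; symmetry; apply Nat.div2_succ_double).
  replace ((- (1)) ^ S n) with (RtoC 1)
    by (replace (S n) with (2 * S p)%nat by lia; now rewrite Cneg1_pow_even).
  replace (RtoC (INR (S n))) with (2 * RtoC (INR (S p))) in *
    by (replace (S n) with (2 * S p)%nat by lia; now rewrite mult_INR, RtoC_mult).
  replace (2 * x * RtoC (INR (S p))) with (x * (2 * RtoC (INR (S p)))) by ring.
  rewrite (Cpow_mult_l 2 (RtoC (INR (S p)))) in *.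
  assert (HP := Cpow_nz _ k (INR_C_neq_0 (S p) ltac:(lia))).
  assert (H2k := Cpow_nz 2 k C2_neq_0).
  set (e := Cexp _) in *; set (P := RtoC (INR (S p)) ^ k) in *; set (c := 2 ^ k) in *.
  intros H2; apply Cminus_eq_contra in H1; apply Cminus_eq_contra in H2.
  replace (e * e - 1) with ((e - 1) * (e + 1)) in * by ring.
  assert (H3 : e + 1 <> 0) by (intros E; apply H2; rewrite E; ring).
  field; easy.
Qed.

Lemma S_fun_periodic (k : nat) (x : C) :
  S_fun (RtoC (INR k)) (x + 2 * RtoC PI * Ci) = S_fun (RtoC (INR k)) x.
Proof.
apply CSeries_ext; intros n; do 3 f_equal.
rewrite Cmult_plus_distr_r, Cexp_plus.
replace (2 * RtoC PI * Ci * RtoC (INR (S n))) with (RtoC PI * Ci * RtoC (INR (2 * S n)))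
  by (rewrite mult_INR, RtoC_mult; change (INR 2) with 2%R; ring).
rewrite Cexp_PI_Ci_INR, Cneg1_pow_even; ring.
Qed.

Theorem theorem7 (m : nat) (hm : (1 <= m)%nat) :
  S_fun (RtoC (INR (4 * m + 1))) (2 * RtoC PI) =
    I_fun (4 * m + 1) (2 * RtoC PI * (1 + Ci))
    + (- 1) ^ m *
      (T_fun (RtoC (INR (4 * m + 1))) (2 * RtoC PI) / 4 ^ m
       + 2 * 4 ^ m * S_fun (RtoC (INR (4 * m + 1))) (2 * RtoC PI)
       - 4 ^ m * I_fun (4 * m + 1) (RtoC PI)).
Proof.
assert (HPI := PI_RGT_0).
assert (Hk : (2 <= 4 * m + 1)%nat) by lia.
assert (Hi : 1 + Ci <> 0) by (intros E; apply (f_equal Re) in E; simpl in E; lra).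
assert (M1 := S_fun_modular m (1 + Ci) hm ltac:(simpl; lra)).
assert (M2 := S_fun_modular m (/ 2) hm ltac:(rewrite <- RtoC_inv by lra; simpl; lra)).
assert (T1 := T_fun_S_fun (4 * m + 1) (RtoC PI) Hk HPI).
assert (T2 := T_fun_S_fun (4 * m + 1) (2 * RtoC PI) Hk ltac:(rewrite <- RtoC_mult; simpl; lra)).
assert (H1 := S_fun_shift (4 * m + 1) (RtoC PI) Hk HPI).
replace (2 * RtoC PI * / (1 + Ci)) with (RtoC PI - RtoC PI * Ci) in M1.
2: { assert (E : (1 + Ci) * (1 - Ci) = 2) by (apply injective_projections; simpl; ring).
  transitivity (RtoC PI * ((1 + Ci) * (1 - Ci)) * / (1 + Ci)); [field; easy|].
  rewrite E; ring. }
replace (S_fun (RtoC (INR (4 * m + 1))) (2 * RtoC PI * (1 + Ci)))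
  with (S_fun (RtoC (INR (4 * m + 1))) (2 * RtoC PI)) in M1
  by (rewrite <- (S_fun_periodic _ (2 * RtoC PI)); f_equal; ring).
replace (2 * RtoC PI * / / 2) with (2 * (2 * RtoC PI)) in M2 by (field; apply C2_neq_0).
replace (2 * RtoC PI * / 2) with (RtoC PI) in M2 by (field; apply C2_neq_0).
(* From [(1 + i)^4 = -4], the source of the factor [(-1)^m] in the theorem. *)
replace ((1 + Ci) ^ (4 * m)) with ((- (1)) ^ m * 4 ^ m) in M1.
2: { rewrite Cpow_mult_r, <- Cpow_mult_l; f_equal; apply injective_projections; simpl; ring. }
assert (H4 : RtoC 4 <> 0) by (intros E; apply RtoC_inj in E; lra).
assert (Hy := Cpow_nz 4 m H4).
assert (E2 : 2 ^ (4 * m) = 4 ^ m * 4 ^ m)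
  by (rewrite Cpow_mult_r, <- Cpow_mult_l; f_equal; ring).
rewrite Cpow_inv, E2 in M2 by apply C2_neq_0.
rewrite Cpow_add_r, E2, Cpow_1_r in H1.
change (RtoC (-1)) with (RtoC (- (1)%R)); rewrite RtoC_opp.
set (y := 4 ^ m) in *; set (s := (- (1)) ^ m) in *.
set (k := RtoC (INR (4 * m + 1))) in *.
(* Elimination leaves only [S_fun] at [2 PI] and [4 PI] besides the [I_fun] terms. The value at
   [4 PI] enters through [M2] and through both occurrences of [T_fun] at [2 PI], and its
   coefficients agree on the two sides. Only the left-hand [S_fun] is expanded by [M1], since the
   same value stays on the right. *)
rewrite M1 at 1; rewrite H1, T1, M2, T2.
field; easy.
Qed.
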